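(* Let $\rho_1=3+\sqrt6$ and $\rho_2=3-\sqrt6$. Then, for all $d\ge1$, \begin{align*} h_1(\Delta_3^d)&=8\cdot2^d-3d-7,\\ h_2(\Delta_3^d)&=c(\Delta_3^d)+1=2\cdot2^d-1,\\ h_1(\Delta_4^d)&=\tfrac{3}{20}(32+13\sqrt6)\rho_1^d+\tfrac{3}{20}(32-13\sqrt6)\rho_2^d-\tfrac{128}{5}\cdot2^d+6d+17,\\ h_2(\Delta_4^d)&=\tfrac{1}{20}(32+13\sqrt6)\rho_1^d+\tfrac{1}{20}(32-13\sqrt6)\rho_2^d-\tfrac{16}{5}\cdot2^d+1,\\ h_3(\Delta_4^d)&=c(\Delta_4^d)+1=\tfrac1{20}(4+\sqrt6)\rho_1^d+\tfrac1{20}(4-\sqrt6)\rho_2^d+\tfrac85\cdot2^d-1. \end{align*}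
   Context: Braids. $B_n$ ($n\ge1$) is the braid group with generators $\sigma_1,\dots,\sigma_{n-1}$ and relations $\sigma_i\sigma_j=\sigma_j\sigma_i$ for $|i-j|\ge2$, $\sigma_i\sigma_j\sigma_i=\sigma_j\sigma_i\sigma_j$ for $|i-j|=1$; $B_\infty$ is the direct limit of the $B_n$. $B_n^+$, $B_\infty^+$ are the monoids with the same presentations; they embed in the groups and their elements are called positive braids. For positive braids, $x\preccurlyeq y$ means $y=xt$ for some positive braid $t$, and $\mathrm{Div}(y)=\{x\in B_\infty^+ : x\preccurlyeq y\}$. $\Delta_1=1$ and $\Delta_n=\sigma_1\sigma_2\cdots\sigma_{n-1}\Delta_{n-1}$. Ordering. A braid word is a word in the letters $\sigma_i^{\pm1}$; $[w]$ denotes the braid represented by $w$. The main generator of a nonempty braid word is $\sigma_m$ where $m$ is the largest index such that $\sigma_m$ or $\sigma_m^{-1}$ occurs; the word is $\sigma$-positive if its main generator $\sigma_m$ occurs but $\sigma_m^{-1}$ does not. The main generator of a positive braid $z\neq1$ is that of any positive word representing it. Heights. For $r\ge1$, $x<_r y$ means that $x^{-1}y$ has a $\sigma$-positive expression whose main generator is $\sigma_m$ with $m\ge r$; this is a strict partial order. The $r$-height $h_r(z)$ of a positive braid $z$ is the maximal length (number of elements) of a $<_r$-chain contained in $\mathrm{Div}(z)$. Complexity. A braid word $w$ is drawn in $\Gamma(z)$ from $x\in\mathrm{Div}(z)$ if $x[v]\in\mathrm{Div}(z)$ for every prefix $v$ of $w$. For a positive braid $z\neq1$ with main generator $\sigma_m$,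 the complexity $c(z)$ is the maximal number of letters $\sigma_m$ in a $\sigma$-positive word drawn in $\Gamma(z)$ from some $x\in\mathrm{Div}(z)$. *)

(* Defs.v *)
From HB Require Import structures.
From mathcomp Require Import all_boot all_order all_algebra.
From mathcomp Require Import boolp classical_sets functions cardinality reals.

Set Implicit Arguments.
Unset Strict Implicit.
Unset Printing Implicit Defensive.

Local Open Scope quotient_scope.
Local Open Scope classical_set_scope.
Local Open Scope group_scope.

Section Presentation.
Variables (A : choiceType) (R : seq A -> seq A -> Prop).

Inductive cong : seq A -> seq A -> Prop :=
| cong_refl u : cong u u
| cong_sym u v of cong u v : cong v u
| cong_trans u v w of cong u v & cong v w : cong u w
| cong_step p q u v of R u v : cong (p ++ u ++ q) (p ++ v ++ q).

Definition congb (u v : seq A) : bool := `[< cong u v >].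

Lemma congb_refl : reflexive congb.
Proof. by move=> u; apply/asboolP; exact: cong_refl. Qed.

Lemma congb_sym : symmetric congb.
Proof. by move=> u v; apply/asboolP/asboolP; exact: cong_sym. Qed.

Lemma congb_trans : transitive congb.
Proof.
move=> v u w /asboolP uv /asboolP vw; apply/asboolP; exact: cong_trans uv vw.
Qed.

Definition cong_equiv := EquivRel congb congb_refl congb_sym congb_trans.

(* The monoid < A | u = v for R u v >, as the quotient of the words over A. *)
Definition presented : Type := {eq_quot cong_equiv}.
HB.instance Definition _ : EqQuotient _ cong_equiv presented :=
  EqQuotient.on presented.
HB.instance Definition _ := Choice.on presented.

Definition class_of (w : seq A) : presented := \pi_presented w.

Lemma class_ofP u v : class_of u = class_of v <-> cong u v.
Proof.
by split=> [/eqquotP/asboolP|uv]; last apply/eqquotP/asboolP.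
Qed.

Lemma cong_repr w : cong (repr (class_of w)) w.
Proof. by apply/class_ofP; rewrite /class_of reprK. Qed.

Lemma class_of_repr (x : presented) : class_of (repr x) = x.
Proof. exact: reprK. Qed.

Lemma cong_cat2 p q u v : cong u v -> cong (p ++ u ++ q) (p ++ v ++ q).
Proof.
elim=> [w|a b _ IH|a b c _ IHab _ IHbc|p' q' a b Rab].
- exact: cong_refl.
- exact: cong_sym.
- exact: cong_trans IHab IHbc.
- have := cong_step (p ++ p') (q' ++ q) Rab; by rewrite !catA.
Qed.

Lemma cong_cat u u' v v' : cong u u' -> cong v v' -> cong (u ++ v) (u' ++ v').
Proof.
move=> uu' vv'; apply: (@cong_trans _ (u' ++ v)).
  exact: (@cong_cat2 [::] v).
by have := @cong_cat2 u' [::] _ _ vv'; rewrite !cats0.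
Qed.

Definition pres_mul (x y : presented) : presented :=
  class_of (repr x ++ repr y).

Lemma pres_mulE u v :
  pres_mul (class_of u) (class_of v) = class_of (u ++ v).
Proof. by apply/class_ofP/cong_cat; exact: cong_repr. Qed.

Lemma pres_mulA : associative pres_mul.
Proof.
move=> x y z; rewrite -(class_of_repr x) -(class_of_repr y) -(class_of_repr z).
by rewrite !pres_mulE catA.
Qed.

Lemma pres_mul1g : left_id (class_of [::]) pres_mul.
Proof. by move=> x; rewrite -(class_of_repr x) pres_mulE. Qed.

Lemma pres_mulg1 : right_id (class_of [::]) pres_mul.
Proof. by move=> x; rewrite -(class_of_repr x) pres_mulE cats0. Qed.

HB.instance Definition _ :=
  isMonoid.Build presented pres_mulA pres_mul1g pres_mulg1.

Lemma class_of_cat u v : class_of (u ++ v) = class_of u * class_of v.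
Proof. by rewrite -pres_mulE. Qed.

End Presentation.

(* Generators are numbered from 1: k : nat codes sigma_(k+1). *)
Definition gen := nat.
Definition gen_index (k : gen) : nat := k.+1.

Inductive braid_rel : seq gen -> seq gen -> Prop :=
| braid_far i j of (i.+2 <= j)%N || (j.+2 <= i)%N :
    braid_rel [:: i; j] [:: j; i]
| braid_near i j of (i.+1 == j) || (j.+1 == i) :
    braid_rel [:: i; j; i] [:: j; i; j].

(* The direct limits of the B_n^+ and of the B_n along sigma_i |-> sigma_i are
   presented by the union of the generators and relations of all levels. *)
Definition posbraid := presented braid_rel.
HB.instance Definition _ := Monoid.on posbraid.

(* (k, true) is the letter k, and (k, false) its inverse. *)
Definition letter := (gen * bool)%type.
Definition flip (a : letter) : letter := (a.1, ~~ a.2).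
Definition pos_word : seq gen -> seq letter := map (fun k => (k, true)).
Definition inv_word (w : seq letter) : seq letter := rev (map flip w).

Inductive group_rel : seq letter -> seq letter -> Prop :=
| group_braid u v of braid_rel u v : group_rel (pos_word u) (pos_word v)
| group_cancel a : group_rel [:: a; flip a] [::].

Definition braid := presented group_rel.
HB.instance Definition _ := Monoid.on braid.

Lemma flipK : involutive flip.
Proof. by case=> k b; rewrite /flip /= negbK. Qed.

Lemma inv_wordK : involutive inv_word.
Proof.
move=> w; rewrite /inv_word map_rev revK -map_comp map_id_in // => a _ /=.
exact: flipK.
Qed.

Lemma inv_word_cat u v : inv_word (u ++ v) = inv_word v ++ inv_word u.
Proof. by rewrite /inv_word map_cat rev_cat. Qed.

Lemma cong_mulwV w : cong group_rel (w ++ inv_word w) [::].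
Proof.
elim: w => [|a w IH]; first exact: cong_refl.
rewrite -cat1s inv_word_cat -catA [w ++ _ ++ _]catA.
apply: (@cong_trans _ _ _ ([:: a] ++ [::] ++ inv_word [:: a])).
  exact: cong_cat2.
have := cong_step [::] [::] (group_cancel a); exact.
Qed.

Lemma cong_mulVw w : cong group_rel (inv_word w ++ w) [::].
Proof. by rewrite -{2}(inv_wordK w); exact: cong_mulwV. Qed.

Lemma cong_inv u v :
  cong group_rel u v -> cong group_rel (inv_word u) (inv_word v).
Proof.
move=> uv; apply: (@cong_trans _ _ _ (inv_word u ++ v ++ inv_word v)).
  rewrite -{1}[inv_word u]cats0; apply: cong_cat (cong_refl _ _) _.
  exact/cong_sym/cong_mulwV.
rewrite catA -{2}[inv_word v]cat0s; apply: cong_cat (cong_refl _ _).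
apply: cong_trans (cong_mulVw u); apply: cong_cat (cong_refl _ _) _.
exact: cong_sym.
Qed.

Definition braid_inv (x : braid) : braid :=
  class_of group_rel (inv_word (repr x)).

HB.instance Definition _ := hasInv.Build braid braid_inv.

Lemma class_of_inv w :
  class_of group_rel (inv_word w) = braid_inv (class_of group_rel w).
Proof. by apply/class_ofP/cong_inv/cong_sym/cong_repr. Qed.

Lemma braid_mulVg : left_inverse (1 : braid) braid_inv *%g.
Proof.
move=> x; rewrite -(class_of_repr x) -class_of_inv -class_of_cat.
by apply/class_ofP/cong_mulVw.
Qed.

Lemma braid_mulgV : right_inverse (1 : braid) braid_inv *%g.
Proof.
move=> x; rewrite -(class_of_repr x) -class_of_inv -class_of_cat.
by apply/class_ofP/cong_mulwV.
Qed.

HB.instance Definition _ := Monoid_isGroup.Build braid braid_mulVg braid_mulgV.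

Definition braid_of (w : seq letter) : braid := class_of group_rel w.
Definition posbraid_of (w : seq gen) : posbraid := class_of braid_rel w.

Lemma posbraid_ofM u v : posbraid_of (u ++ v) = posbraid_of u * posbraid_of v.
Proof. exact: class_of_cat. Qed.

Lemma braid_ofM u v : braid_of (u ++ v) = braid_of u * braid_of v.
Proof. exact: class_of_cat. Qed.

Lemma braid_ofV w : braid_of (inv_word w) = (braid_of w)^-1.
Proof. exact: class_of_inv. Qed.

(* The canonical morphism B_oo^+ -> B_oo (an embedding, by Garside). *)
Definition to_braid (x : posbraid) : braid := braid_of (pos_word (repr x)).

Lemma cong_pos_word u v :
  cong braid_rel u v -> cong group_rel (pos_word u) (pos_word v).
Proof.
elim=> {u v} [u|u v _|u v w _ IHuv _|p q u v uv].
- exact: cong_refl.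
- exact: cong_sym.
- exact: cong_trans.
- by rewrite /pos_word !map_cat; exact/cong_step/group_braid.
Qed.

Lemma to_braidE w : to_braid (posbraid_of w) = braid_of (pos_word w).
Proof. by apply/class_ofP/cong_pos_word; exact: cong_repr. Qed.

Lemma to_braidM : {morph to_braid : x y / x * y}.
Proof.
move=> x y; rewrite -(class_of_repr x) -(class_of_repr y) -class_of_cat.
by rewrite !to_braidE /pos_word map_cat /braid_of class_of_cat.
Qed.

Lemma to_braid1 : to_braid 1 = 1.
Proof. exact: (to_braidE [::]). Qed.

Definition sigma (i : nat) : posbraid := posbraid_of [:: i.-1].

(* Delta 0 = 1 is a dummy value; the product is empty for n = 1. *)
Fixpoint Delta (n : nat) : posbraid :=
  if n is m.+1 then (\prod_(1 <= i < m.+1) sigma i) * Delta m else 1.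

Lemma Delta3E : Delta 3 = posbraid_of [:: 0; 1; 0]%N.
Proof.
rewrite /Delta unlock /= !mulg1 -[[:: _, _ & _]]/([:: 0] ++ [:: 1] ++ [:: 0])%N.
by rewrite !posbraid_ofM mulgA.
Qed.

Definition posbraid_dvd (x y : posbraid) : Prop := exists t, y = x * t.

Definition Div (y : posbraid) : set posbraid := [set x | posbraid_dvd x y].

(* Both indices are 0 for the empty word, which has no main generator. *)
Definition main_index (w : seq letter) : nat := \max_(a <- w) gen_index a.1.
Definition pos_main_index (w : seq gen) : nat := \max_(k <- w) gen_index k.

Definition count_sigma (m : nat) (w : seq letter) : nat :=
  count (fun a => (gen_index a.1 == m) && a.2) w.
Definition count_sigmaV (m : nat) (w : seq letter) : nat :=
  count (fun a => (gen_index a.1 == m) && ~~ a.2) w.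

Definition sigma_positive (w : seq letter) : Prop :=
  (0 < count_sigma (main_index w) w)%N /\
  count_sigmaV (main_index w) w = 0%N.

Definition braid_lt (r : nat) (x y : posbraid) : Prop :=
  exists w : seq letter,
    [/\ braid_of w = (to_braid x)^-1 * to_braid y,
        sigma_positive w & (r <= main_index w)%N].

(* 0 if P has no maximum: a positive value certifies that it exists. *)
Definition maximum (P : set nat) : nat :=
  xget 0%N [set n | P n /\ forall k, P k -> (k <= n)%N].

Definition braid_chain (r : nat) (C : set posbraid) : Prop :=
  forall x y, C x -> C y -> x <> y -> braid_lt r x y \/ braid_lt r y x.

Definition height (r : nat) (z : posbraid) : nat :=
  maximum [set n | exists C : set posbraid,
    [/\ C `<=` Div z, braid_chain r C & (C #= `I_n)%card]].

Definition drawn (z x : posbraid) (w : seq letter) : Prop :=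
  forall v, prefix v w ->
    exists2 y, Div z y & to_braid y = to_braid x * braid_of v.

(* The choice of the positive word is irrelevant (posbraid_mainE), and the
   value is 0 for z = 1, which has no main generator. *)
Definition posbraid_main (z : posbraid) : nat := pos_main_index (repr z).

Lemma cong_pos_main u v :
  cong braid_rel u v -> pos_main_index u = pos_main_index v.
Proof.
rewrite /pos_main_index; elim=> {u v} // [u v w _ -> _ -> //|p q _ _ [] i j _].
- rewrite !big_cat /=; congr (maxn _ (maxn _ _)).
  by rewrite !big_cons big_nil !maxn0 maxnC.
- rewrite !big_cat /=; congr (maxn _ (maxn _ _)).
  rewrite !big_cons big_nil !maxn0.
  by rewrite maxnCA maxnn [RHS]maxnCA maxnn maxnC.
Qed.

Lemma posbraid_mainE w : posbraid_main (posbraid_of w) = pos_main_index w.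
Proof. by apply: cong_pos_main; exact: cong_repr. Qed.

Definition complexity (z : posbraid) : nat :=
  maximum [set n | exists x w,
    [/\ Div z x, sigma_positive w, drawn z x w
      & n = count_sigma (posbraid_main z) w]].

(* Main.v *)
(* Two positive braids are incomparable for <_r exactly when they lie in the
   same coset of B_r, and each coset meeting Div z contains a unique braid
   without right divisor sigma_i (i < r): h_r(z) counts these heads. That a
   sigma-positive braid is nontrivial is read off an action by positive rational
   maps. Conversely, any two vertices of the graph of Div z that lie in different
   cosets of B_r are joined, in one of the two directions, by a sigma-positive
   walk inside it with main generator sigma_m, m >= r: handles can be pushed
   without leaving Div z, since Div z has lcm's, and the process ends since Div z
   is finite and sigma-positive walks are acyclic. Concatenating such walks also
   gives c(z) + 1 = h_m(z). Finally, the heads of Delta_n^d are counted through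
   right normal forms x_1 ... x_d of simple braids, which obey a local condition
   on descent sets; this leaves linear recurrences to solve. *)
Require Import Defs.
From mathcomp Require Import all_boot all_order all_algebra.
From mathcomp Require Import boolp classical_sets reals.
From mathcomp Require Import functions cardinality.
From mathcomp Require Import ring lra zify.

Set Implicit Arguments.
Unset Strict Implicit.
Unset Printing Implicit Defensive.

Import Order.TTheory GRing.Theory Num.Theory.

Local Open Scope ring_scope.

(** Letters are numbered from 0: [flat r], [is_head r] and [heads r] concern the letters [k < r],
    hence $B_{r+1}$, and answer for $h_{r+1}$. The delicate point is to compare two vertices without
    leaving $\mathrm{Div}(z)$. This is an induction on the largest letter [m]: two edges [m] whose
    sources lie in one coset are compared by comparing the sources at the previous level
    ([lew_push]), and likewise from targets to sources ([lew_pull]). These local comparisons become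
    global by a confluence argument, whose measure is the number of vertices strictly above (or
    below) a given one. Right normal forms suit heads because heads are defined by right divisors,
    and the right descents of a normal product are those of its last factor. So a head is recognised
    on its last factor, and counting heads amounts to iterating a transfer matrix. Its states can be
    taken to be descent sets instead of simple braids: 4 instead of 6 for three strands, 8 instead
    of 24 for four. The eigenvalues seen in the formulas are $1$, $2$ and, for four strands,
    $3\pm\sqrt6$. *)

(** * A positive rational action detecting sigma-positive braids *)

Definition coords := nat -> rat * rat.

Definition coords_pos (f : coords) := forall j, 0 < (f j).1 /\ 0 < (f j).2.

(* Dynnikov's action on the coordinates of laminations, with maximum and sum
   replaced by sum and product. *)
Definition twist (e : bool) (p q : rat * rat) : (rat * rat) * (rat * rat) :=
  let: (a, b) := p in let: (c, d) := q in
  if e then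
    let E := b * c + a * (1 + b) * (1 + d) in
    ((a + a * b + b * c, b * c * d / E), (a * c * d / (a + a * d + c), E / c))
  else
    let E := a * b + c * (1 + b) * (1 + d) in
    ((a * c / (c + b * c + a * b), a * b * d / E),
     ((c + c * d + a) / d, E / a)).

Definition letter_act (x : letter) (f : coords) : coords := fun j =>
  let t := twist x.2 (f x.1) (f x.1.+1) in
  if j == x.1 then t.1 else if j == x.1.+1 then t.2 else f j.

Definition word_act (w : seq letter) (f : coords) : coords :=
  foldl (fun g x => letter_act x g) f w.

Ltac posit := repeat first [assumption | apply: addr_gt0 | apply: mulr_gt0
  | apply: divr_gt0 | rewrite invr_gt0 | exact: ltr01].

Ltac nz := repeat (apply/andP; split); apply: lt0r_neq0; posit.

Lemma twist_pos e p q : 0 < p.1 -> 0 < p.2 -> 0 < q.1 -> 0 < q.2 ->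
  [/\ 0 < (twist e p q).1.1, 0 < (twist e p q).1.2, 0 < (twist e p q).2.1
    & 0 < (twist e p q).2.2].
Proof.
case: p q => [a b] [c d] /= a0 b0 c0 d0.
by case: e; split; rewrite /=; posit.
Qed.

Lemma letter_act_pos x f : coords_pos f -> coords_pos (letter_act x f).
Proof.
move=> fpos j; rewrite /letter_act.
have [[a0 b0] [c0 d0]] := (fpos x.1, fpos x.1.+1).
have [? ? ? ?] := twist_pos x.2 a0 b0 c0 d0.
by case: eqP => // _; case: eqP.
Qed.

Lemma word_act_pos w f : coords_pos f -> coords_pos (word_act w f).
Proof. by elim: w f => //= x w IH f /(letter_act_pos x)/IH. Qed.

Lemma word_act_cat u v f : word_act (u ++ v) f = word_act v (word_act u f).
Proof. exact: foldl_cat. Qed.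

Lemma twistK e p q : 0 < p.1 -> 0 < p.2 -> 0 < q.1 -> 0 < q.2 ->
  twist (~~ e) (twist e p q).1 (twist e p q).2 = (p, q).
Proof.
case: p q => [a b] [c d] /= a0 b0 c0 d0.
case: e => /=; congr ((_, _), (_, _)); field; nz.
Qed.

(** The braid relation on three consecutive pairs of coordinates. The formulas contain no
    subtraction, so positivity keeps every denominator nonzero and only an identity of rational
    functions remains. *)
Lemma twist_near (x y z : rat * rat) :
  0 < x.1 -> 0 < x.2 -> 0 < y.1 -> 0 < y.2 -> 0 < z.1 -> 0 < z.2 ->
  let t := twist true in
  let u := t x y in let v := t u.2 z in let w := t u.1 v.1 in
  let u' := t y z in let v' := t x u'.1 in let w' := t v'.2 u'.2 in
  [/\ w.1 = v'.1, w.2 = w'.1 & v.2 = w'.2].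
Proof.
case: x y z => [a b] [c d] [g h] /= a0 b0 c0 d0 g0 h0.
split=> /=; congr (_, _); field; nz.
Qed.

Lemma letter_act_flipK x f : coords_pos f ->
  letter_act (flip x) (letter_act x f) = f.
Proof.
case: x => k e fpos; apply: funext => j; rewrite /letter_act /=.
have -> : k.+1 == k = false by apply/negbTE; rewrite neq_ltn ltnSn orbT.
rewrite !eqxx.
have [[a0 b0] [c0 d0]] := (fpos k, fpos k.+1).
rewrite twistK //=; case: (eqVneq j k) => [-> //|_].
by case: (eqVneq j k.+1) => [-> |_].
Qed.

Lemma letter_act_far e e' i j f : (i.+2 <= j)%N ->
  letter_act (i, e) (letter_act (j, e') f)
  = letter_act (j, e') (letter_act (i, e) f).
Proof.
move=> ij; apply: funext => l; rewrite /letter_act /=.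
have -> : (i == j) = false by lia.
have -> : (i == j.+1) = false by lia.
have -> : (i.+1 == j) = false by lia.
have -> : (i.+1 == j.+1) = false by lia.
have -> : (j == i) = false by lia.
have -> : (j == i.+1) = false by lia.
have -> : (j.+1 == i) = false by lia.
have -> : (j.+1 == i.+1) = false by lia.
case: (eqVneq l i) => [->|_].
  have -> : (i == j) = false by lia.
  by have -> : (i == j.+1) = false by lia.
case: (eqVneq l i.+1) => [->|_] //.
have -> : (i.+1 == j) = false by lia.
by have -> : (i.+1 == j.+1) = false by lia.
Qed.

Lemma letter_act_near i f : coords_pos f ->
  word_act [:: (i, true); (i.+1, true); (i, true)] f
  = word_act [:: (i.+1, true); (i, true); (i.+1, true)] f.
Proof.
move=> fpos; apply: funext => l; rewrite /= /letter_act.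
rewrite -[(i, true).1]/i -[(i.+1, true).1]/i.+1.
rewrite -[(i, true).2]/true -[(i.+1, true).2]/true.
have [[a0 b0] [c0 d0]] := (fpos i, fpos i.+1); have [g0 h0] := fpos i.+2.
have [H1 H2 H3] := twist_near a0 b0 c0 d0 g0 h0.
have E1 : (i.+1 == i) = false by lia.
have E2 : (i.+2 == i) = false by lia.
have E3 : (i == i.+1) = false by lia.
have E4 : (i.+2 == i.+1) = false by lia.
have E5 : (i == i.+2) = false by lia.
have E6 : (i.+1 == i.+2) = false by lia.
rewrite ?(E1, E2, E3, E4, E5, E6, eqxx).
case: (l =P i) => [E|_]; rewrite ?E ?(E1, E2, E3, E4, E5, E6, eqxx) ?H1 //.
case: (l =P i.+1) => [E|_]; rewrite ?E ?(E1, E2, E3, E4, E5, E6, eqxx) ?H2 //.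
by case: (l =P i.+2) => [E|_]; rewrite ?E ?(E1, E2, E3, E4, E5, E6, eqxx) ?H3.
Qed.

Lemma cong_word_act u v : cong group_rel u v ->
  forall f, coords_pos f -> word_act u f = word_act v f.
Proof.
elim=> {u v} [//|u v _ IH f fpos|u v w _ IHu _ IHv f fpos|p q u v uv f fpos].
- by rewrite IH.
- by rewrite IHu ?IHv.
rewrite !word_act_cat; congr word_act.
have /(word_act_pos p) := fpos; move: (word_act p f) => g gpos.
case: uv => {u v} [u v []|a] /=; last by rewrite letter_act_flipK.
  by move=> i j /orP[] ij /=; [rewrite -letter_act_far|rewrite letter_act_far].
move=> i j /orP[] /eqP <-; first exact: letter_act_near.
by apply: esym; exact: letter_act_near.
Qed.

Lemma letter_act_lower x m f : (x.1 < m)%N ->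
  (letter_act x f m.+1) = f m.+1.
Proof.
move=> xm; rewrite /letter_act.
have -> : (m.+1 == x.1) = false by lia.
by have -> : (m.+1 == x.1.+1) = false by lia.
Qed.

Lemma letter_act_main m f : coords_pos f ->
  (letter_act (m, true) f m.+1).1 < (f m.+1).1.
Proof.
move=> fpos; have [[a0 b0] [c0 d0]] := (fpos m, fpos m.+1).
rewrite /letter_act /= eqxx.
have -> : (m.+1 == m) = false by lia.
move: a0 b0 c0 d0; case: (f m) => a b; case: (f m.+1) => c d /= a0 b0 c0 d0.
by rewrite ltr_pdivrMr; posit; rewrite !mulrDr -subr_gt0; nra.
Qed.

(** Weak form of sigma-positivity, stable under concatenation; it becomes strict with the separate
    condition [(m, true) \in w]. *)
Definition lower_letters (m : nat) (w : seq letter) :=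
  all (fun a => (a.1 < m)%N || (a == (m, true))) w.

Lemma lower_letters_act m w f : lower_letters m w -> coords_pos f ->
  ((word_act w f m.+1).1 <= (f m.+1).1)
  && (((m, true) \in w) ==> ((word_act w f m.+1).1 < (f m.+1).1)).
Proof.
elim: w f => [|x w IH] f /=; first by rewrite lexx.
case/andP=> xm wm fpos; have gpos := letter_act_pos x fpos.
have /andP[le lt] := IH _ wm gpos.
case/orP: xm => [xm|/eqP xm].
  move: le lt; rewrite in_cons (letter_act_lower _ xm) => -> /=.
  by case: eqP => // xE; move: xm; rewrite -xE ltnn.
rewrite in_cons xm eqxx /= in le lt *.
have := letter_act_main m fpos.
by move=> h; rewrite (le_lt_trans le h) (ltW (le_lt_trans le h)).
Qed.

(* The twist by sigma_m decreases the first coordinate of the strand after it,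
   and the twists of smaller index do not change it. *)
Lemma sigma_positive_neq1 m w : lower_letters m w -> (m, true) \in w ->
  braid_of w <> 1%g.
Proof.
move=> low mw /class_ofP w1.
have fpos : coords_pos (fun=> (1, 1)) by move=> j.
have /andP[_] := lower_letters_act low fpos.
by rewrite mw (cong_word_act w1 fpos) ltxx.
Qed.

(** * Garside theory of the positive monoid: cancellation and lcm's *)

Local Open Scope group_scope.

Definition far (i j : gen) := (i.+2 <= j)%N || (j.+2 <= i)%N.
Definition near (i j : gen) := (i.+1 == j) || (j.+1 == i).

Lemma farC i j : far i j = far j i.
Proof. by rewrite /far orbC. Qed.

Lemma nearC i j : near i j = near j i.
Proof. by rewrite /near orbC. Qed.

Variant gen_cmp i j : bool -> bool -> bool -> Prop :=
| GenEq of i = j : gen_cmp i j true false false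
| GenFar of far i j : gen_cmp i j false true false
| GenNear of near i j : gen_cmp i j false false true.

Lemma gen_cmpP i j : gen_cmp i j (i == j) (far i j) (near i j).
Proof.
case: (eqVneq i j) => [<-|ij].
  have -> : far i i = false by rewrite /far; lia.
  have -> : near i i = false by rewrite /near; lia.
  exact: GenEq.
case F : (far i j).
  have -> : near i j = false by move: F; rewrite /far /near; lia.
  exact: GenFar.
have N : near i j by move: F ij; rewrite /far /near; lia.
by rewrite N; exact: GenNear.
Qed.

Notation gn k := (posbraid_of [:: k]).

Definition mulw (w : seq gen) (x : posbraid) : posbraid := posbraid_of w * x.

Lemma mulw_cons k w x : mulw (k :: w) x = gn k * mulw w x.
Proof. by rewrite /mulw -cat1s posbraid_ofM mulgA. Qed.

Lemma mulw_nil x : mulw [::] x = x.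
Proof. exact: mul1g. Qed.

Lemma posbraid_ind (P : posbraid -> Prop) : (forall w, P (posbraid_of w)) ->
  forall x, P x.
Proof. by move=> H x; rewrite -(class_of_repr x); exact: H. Qed.

Lemma gn_far i j x : far i j -> gn i * (gn j * x) = gn j * (gn i * x).
Proof.
move=> ij; rewrite -[x in LHS]mulw_nil -[x in RHS]mulw_nil -!mulw_cons.
congr (_ * _); apply/class_ofP; exact: (cong_step [::] [::] (braid_far ij)).
Qed.

Lemma gn_near i j x : near i j ->
  gn i * (gn j * (gn i * x)) = gn j * (gn i * (gn j * x)).
Proof.
move=> ij; rewrite -[x in LHS]mulw_nil -[x in RHS]mulw_nil -!mulw_cons.
congr (_ * _); apply/class_ofP; exact: (cong_step [::] [::] (braid_near ij)).
Qed.

Lemma gn_mulw k w x : all (far k) w -> gn k * mulw w x = mulw w (gn k * x).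
Proof.
elim: w => [|l w IH] /=; first by rewrite !mulw_nil.
by case/andP=> kl kw; rewrite !mulw_cons -IH // gn_far.
Qed.

Lemma cong_size u v : cong braid_rel u v -> size u = size v.
Proof.
by elim=> {u v} // [u v w _ -> _ -> //|p q _ _ [] i j _]; rewrite !size_cat.
Qed.

Definition pbsize (x : posbraid) : nat := size (repr x).

Lemma pbsizeE w : pbsize (posbraid_of w) = size w.
Proof. by apply: cong_size; exact: cong_repr. Qed.

Lemma pbsizeM x y : pbsize (x * y) = (pbsize x + pbsize y)%N.
Proof.
elim/posbraid_ind: x => u; elim/posbraid_ind: y => v.
by rewrite -posbraid_ofM !pbsizeE size_cat.
Qed.

Lemma pbsize1 : pbsize 1 = 0%N.
Proof. exact: (pbsizeE [::]). Qed.

Lemma pbsize_gn k : pbsize (gn k) = 1%N.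
Proof. exact: (pbsizeE [:: k]). Qed.

Lemma pbsize_eq0 x : pbsize x = 0%N -> x = 1.
Proof. by elim/posbraid_ind: x => w; rewrite pbsizeE => /size0nil ->. Qed.

(* gn i * mulw (lcm_cpl i j) 1 is the right lcm of the letters i and j. *)
Definition lcm_cpl (i j : gen) : seq gen :=
  if i == j then [::] else if far i j then [:: j] else [:: j; i].

Lemma lcm_cplE i j x :
  gn i * mulw (lcm_cpl i j) x = gn j * mulw (lcm_cpl j i) x.
Proof.
rewrite /lcm_cpl (farC j i) (eq_sym j i).
case: gen_cmpP => [->|ij|ij]; rewrite ?mulw_nil // !mulw_cons !mulw_nil.
  exact: gn_far.
exact: gn_near.
Qed.

(** Garside's lemma up to length [n]. The case [i = j] is left cancellation, so that both are proved
    in one induction. *)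
Definition head_split n := forall i j x y, (pbsize x < n)%N ->
  gn i * x = gn j * y ->
  exists z, x = mulw (lcm_cpl i j) z /\ y = mulw (lcm_cpl j i) z.

Lemma head_split_eq n i x y : head_split n -> (pbsize x < n)%N ->
  gn i * x = gn i * y -> x = y.
Proof.
move=> H xn /(H _ _ _ _ xn)[z]; rewrite /lcm_cpl eqxx !mulw_nil.
by case=> -> ->.
Qed.

Lemma head_split_far n i j x y : head_split n -> (pbsize x < n)%N -> far i j ->
  gn i * x = gn j * y -> exists z, x = gn j * z /\ y = gn i * z.
Proof.
move=> H xn + /(H _ _ _ _ xn)[z]; rewrite /lcm_cpl (farC j) (eq_sym j).
by case: gen_cmpP => // _ _; rewrite !mulw_cons !mulw_nil; exists z.
Qed.

Lemma head_split_near n i j x y :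
  head_split n -> (pbsize x < n)%N -> near i j ->
  gn i * x = gn j * y ->
  exists z, x = gn j * (gn i * z) /\ y = gn i * (gn j * z).
Proof.
move=> H xn + /(H _ _ _ _ xn)[z]; rewrite /lcm_cpl (farC j) (eq_sym j).
by case: gen_cmpP => // _ _; rewrite !mulw_cons !mulw_nil; exists z.
Qed.

Section HeadSplitStep.

Variable n : nat.
Hypothesis IH : head_split n.

Let inj i x y : (pbsize x < n)%N -> gn i * x = gn i * y -> x = y.
Proof. exact: head_split_eq. Qed.

Let sfar i j x y : (pbsize x < n)%N -> far i j ->
  gn i * x = gn j * y -> exists z, x = gn j * z /\ y = gn i * z.
Proof. exact: head_split_far. Qed.

Let snear i j x y : (pbsize x < n)%N -> near i j ->
  gn i * x = gn j * y ->
  exists z, x = gn j * (gn i * z) /\ y = gn i * (gn j * z).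
Proof. exact: head_split_near. Qed.

(** These relations to [k] leave open whether [i] and [j] commute or braid; either case closes the
    diagram with its own common multiple of the three letters. *)
Lemma pivot_far_near i j k z z' : far k j -> near k i ->
  (pbsize (gn j * z')%g < n.+1)%N -> gn i * (gn k * z) = gn j * z' ->
  exists t, gn k * (gn i * z) = mulw (lcm_cpl i j) t
         /\ gn k * z' = mulw (lcm_cpl j i) t.
Proof.
move=> kj ki sz e; have : (pbsize (gn k * z)%g < n)%N.
  by move: sz; rewrite -e !pbsizeM !pbsize_gn.
move=> sz1; have sz2 : (pbsize z < n)%N by move: sz1; rewrite pbsizeM; lia.
have jk : far j k by rewrite farC.
have ik : near i k by rewrite nearC.
rewrite /lcm_cpl (farC j) (eq_sym j); case: gen_cmpP => [ij|ij|ij].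
- by move: kj ki; rewrite -ij /far /near; lia.
- have [t [e1 e2]] := sfar sz1 ij e.
  have [t' [e3 e4]] := sfar sz2 kj e1.
  exists (gn k * (gn i * t')); rewrite !mulw_cons !mulw_nil e2 e4 e3.
  split; last by rewrite (gn_near _ ki).
  by rewrite (gn_far t' ij) (gn_far _ kj).
- have [t [e1 e2]] := snear sz1 ij e.
  have [y [e3 e4]] := sfar sz2 kj e1.
  have szt : (pbsize t < n)%N.
    by move: sz1; rewrite e1 !pbsizeM !pbsize_gn; lia.
  have [x [e5 e6]] := snear szt ik e4.
  exists (gn k * (gn i * (gn j * x))).
  rewrite !mulw_cons !mulw_nil e2 e3 e6 e5; split.
    rewrite (gn_near (gn k * x) ij) (gn_far _ kj) (gn_far x jk).
    by rewrite (gn_near _ ki).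
  by rewrite (gn_far _ jk) (gn_near _ ki) (gn_near x ij) (gn_far _ kj).
Qed.

(** The transitivity step: a braid that factors through the lcm's of [k] with [i] and of [k] with
    [j] also factors through that of [i] and [j]. It is a cube condition on three letters, checked
    for each configuration of [i], [j] around [k]. *)
Lemma head_split_pivot i j k z z' :
  (pbsize (mulw (lcm_cpl k j) z')%g < n.+1)%N ->
  mulw (lcm_cpl k i) z = mulw (lcm_cpl k j) z' ->
  exists t, mulw (lcm_cpl i k) z = mulw (lcm_cpl i j) t
         /\ mulw (lcm_cpl j k) z' = mulw (lcm_cpl j i) t.
Proof.
case: (eqVneq i j) => [<- sz e|neij].
  have <- : z = z'.
    move: sz e; rewrite /lcm_cpl.
    case: gen_cmpP => _; rewrite ?mulw_cons ?mulw_nil //.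
      rewrite pbsizeM pbsize_gn => sz e; apply: (inj _ e).
      by have := congr1 pbsize e; rewrite !pbsizeM; lia.
    rewrite !pbsizeM !pbsize_gn => sz e; have sze := congr1 pbsize e.
    rewrite !pbsizeM !pbsize_gn in sze.
    by apply: inj (inj _ e); rewrite ?pbsizeM ?pbsize_gn; lia.
  by exists (mulw (lcm_cpl i k) z); rewrite /lcm_cpl eqxx !mulw_nil.
case: (eqVneq k i) => [-> sz e|neki].
  by exists z'; rewrite -e /lcm_cpl eqxx !mulw_nil.
case: (eqVneq k j) => [-> sz e|nekj].
  by exists z; rewrite e /lcm_cpl eqxx !mulw_nil.
rewrite {1 2 3 4 6}/lcm_cpl (farC i k) (farC j k) (eq_sym i k) (eq_sym j k).
rewrite (negbTE neki) (negbTE nekj).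
case: (gen_cmpP k i) neki => [//|ki|ki] _;
  case: (gen_cmpP k j) nekj => [//|kj|kj] _;
  rewrite ?mulw_cons ?mulw_nil => sz e.
- have sz1 : (pbsize z < n)%N.
    have := congr1 pbsize e; rewrite !pbsizeM.
    by move: sz; rewrite pbsizeM !pbsize_gn; lia.
  rewrite pbsizeM pbsize_gn in sz.
  have [t [-> ->]] := IH sz1 e; exists (gn k * t).
  by rewrite !gn_mulw // /lcm_cpl; do 2?case: ifP => //=; rewrite ?ki ?kj.
- have [|t [e1 e2]] := pivot_far_near ki kj _ (esym e); first by rewrite e.
  by exists t.
- by have [t [e1 e2]] := pivot_far_near kj ki sz e; exists t.
- have fij : far i j by move: ki kj neij; rewrite /near /far; lia.
  have fji : far j i by rewrite farC.
  have ik : near i k by rewrite nearC.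
  have jk : near j k by rewrite nearC.
  rewrite /lcm_cpl (farC j) (eq_sym j) (negbTE neij) fij.
  have sz1 : (pbsize (gn k * z)%g < n)%N.
    have := congr1 pbsize e; move: sz; rewrite !pbsizeM !pbsize_gn; lia.
  have [t [e1 e2]] := sfar sz1 fij e.
  rewrite pbsizeM pbsize_gn in sz1; have sz2 := congr1 pbsize e1.
  have sz3 := congr1 pbsize e2; rewrite !pbsizeM !pbsize_gn in sz2 sz3.
  have [|x [e3 e4]] := snear _ kj e1; first by lia.
  have [|y [e5 e6]] := snear _ ki e2; first by lia.
  have sz4 := congr1 pbsize e4; rewrite !pbsizeM !pbsize_gn in sz4.
  have e7 : gn j * x = gn i * y.
    apply: (inj _ (etrans (esym e4) e6)); rewrite pbsizeM pbsize_gn; lia.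
  have [|r [e8 e9]] := sfar _ fji e7; first by lia.
  exists (gn k * (gn j * (gn i * (gn k * r)))); rewrite !mulw_cons !mulw_nil.
  rewrite e3 e5 e8 e9; split.
    by rewrite (gn_far _ fij) (gn_near r ik) (gn_near _ kj).
  by rewrite (gn_far _ fji) (gn_near r jk) (gn_near _ ki) (gn_far _ fij).
Qed.

(** Induction on the derivation of the congruence. Only transitivity is not immediate: there the
    head of the middle word is the pivot [k]. *)
Lemma head_split_words u v : cong braid_rel u v -> (size u <= n.+1)%N ->
  forall i j u' v', u = i :: u' -> v = j :: v' ->
  exists t, posbraid_of u' = mulw (lcm_cpl i j) t
         /\ posbraid_of v' = mulw (lcm_cpl j i) t.
Proof.
elim=> {u v} [u|u v uv IHuv|u v w uv IHuv vw IHvw|p q u v uv] sz i j u' v'.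
- move=> -> [<- <-]; exists (posbraid_of u').
  by rewrite /lcm_cpl eqxx !mulw_nil.
- move=> vE uE; rewrite -(cong_size uv) in sz.
  by have [t [e1 e2]] := IHuv sz _ _ _ _ uE vE; exists t.
- move=> uE wE; have szv := sz; rewrite (cong_size uv) in szv.
  case: v => [|k v0] in uv vw IHuv IHvw szv *.
    by have := cong_size uv; rewrite uE.
  have [z [e1 e2]] := IHuv sz _ _ _ _ uE (erefl _).
  have [z' [e3 e4]] := IHvw szv _ _ _ _ (erefl _) wE.
  have [|t [e5 e6]] := head_split_pivot _ (etrans (esym e2) e3).
    by rewrite -e3 pbsizeE.
  by exists t; rewrite e1 e4 e5 e6.
case: p => [|k p] in sz *; last first.
  case=> <- <- [<- <-]; exists (posbraid_of (p ++ u ++ q)).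
  rewrite /lcm_cpl eqxx !mulw_nil; split=> //.
  by apply/class_ofP/cong_sym/cong_step.
case: uv => {u v sz} i' j' ij [<- <-] [<- <-]; exists (posbraid_of q).
  have fij : far i' j' by [].
  rewrite /lcm_cpl (farC j') (eq_sym j').
  by case: gen_cmpP fij => //; rewrite /mulw -!posbraid_ofM.
have fij : near i' j' by [].
rewrite /lcm_cpl (farC j') (eq_sym j').
by case: gen_cmpP fij => //; rewrite /mulw -!posbraid_ofM.
Qed.

End HeadSplitStep.

(* Garside's lemma: the braid relations, read as lcm's of letters, describe all
   coincidences of heads. *)
Lemma gn_head_split i j x y : gn i * x = gn j * y ->
  exists z, x = mulw (lcm_cpl i j) z /\ y = mulw (lcm_cpl j i) z.
Proof.
suff H n : head_split n by exact: (H (pbsize x).+1).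
elim: n => [//|n IH] {}i {}j {}x {}y.
elim/posbraid_ind: x => u; elim/posbraid_ind: y => v; rewrite pbsizeE => sz.
rewrite -!posbraid_ofM => /class_ofP uv.
by apply: (head_split_words IH uv); rewrite ?size_cat ?add1n.
Qed.

Lemma gn_inj k : injective (fun x => gn k * x).
Proof.
by move=> x y /gn_head_split[z]; rewrite /lcm_cpl eqxx !mulw_nil => -[-> ->].
Qed.

Lemma posbraid_lcancel (a x y : posbraid) : a * x = a * y -> x = y.
Proof.
elim/posbraid_ind: a; elim=> [|k w IH].
  by rewrite -!/(mulw _ _) !mulw_nil.
by rewrite -!/(mulw _ _) !mulw_cons => /gn_inj/IH.
Qed.

Definition revb (x : posbraid) : posbraid := posbraid_of (rev (repr x)).

Lemma cong_rev u v : cong braid_rel u v -> cong braid_rel (rev u) (rev v).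
Proof.
elim=> {u v} [u|u v _|u v w _ IHuv _|p q u v uv].
- exact: cong_refl.
- exact: cong_sym.
- exact: cong_trans.
rewrite !rev_cat -!catA; apply: cong_step.
by case: uv => i j ij; [apply: braid_far; rewrite orbC|exact: braid_near].
Qed.

Lemma revbE w : revb (posbraid_of w) = posbraid_of (rev w).
Proof. by apply/class_ofP/cong_rev; exact: cong_repr. Qed.

Lemma revbK : involutive revb.
Proof. by elim/posbraid_ind => w; rewrite !revbE revK. Qed.

Lemma revbM x y : revb (x * y) = revb y * revb x.
Proof.
elim/posbraid_ind: x => u; elim/posbraid_ind: y => v.
by rewrite -posbraid_ofM !revbE rev_cat posbraid_ofM.
Qed.

Lemma posbraid_rcancel (a x y : posbraid) : x * a = y * a -> x = y.
Proof.
by move/(congr1 revb); rewrite !revbM => /posbraid_lcancel/(can_inj revbK).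
Qed.

Lemma gn_tail_split i j x y : x * gn i = y * gn j ->
  exists z, x = z * posbraid_of (rev (lcm_cpl i j))
         /\ y = z * posbraid_of (rev (lcm_cpl j i)).
Proof.
move/(congr1 revb); rewrite !revbM !revbE => /gn_head_split[z [e1 e2]].
exists (revb z); split; first by rewrite -(revbK x) e1 /mulw revbM revbE.
by rewrite -(revbK y) e2 /mulw revbM revbE.
Qed.

Lemma posbraid_rcons w k : posbraid_of (rcons w k) = posbraid_of w * gn k.
Proof. by rewrite -cats1 posbraid_ofM. Qed.

Definition rdvd (s y : posbraid) : Prop := exists x, y = x * s.

Lemma dvd_refl x : posbraid_dvd x x.
Proof. by exists 1; rewrite mulg1. Qed.

Lemma dvd_trans y x z :
  posbraid_dvd x y -> posbraid_dvd y z -> posbraid_dvd x z.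
Proof. by move=> [t ->] [u ->]; exists (t * u); rewrite mulgA. Qed.

Lemma dvd_mulr x t y : posbraid_dvd (x * t) y -> posbraid_dvd x y.
Proof. by move=> [u ->]; exists (t * u); rewrite mulgA. Qed.

Lemma dvd_mul2l a x y : posbraid_dvd (a * x) (a * y) <-> posbraid_dvd x y.
Proof.
split=> [[t]|[t ->]]; last by exists t; rewrite mulgA.
by rewrite -mulgA => /posbraid_lcancel ->; exists t.
Qed.

Lemma rdvd_rev s y : rdvd s y <-> posbraid_dvd (revb s) (revb y).
Proof.
split=> [[x ->]|[t /(congr1 revb)]]; first by exists (revb x); rewrite revbM.
by rewrite revbM !revbK => ->; exists (revb t).
Qed.

Lemma posbraid_head x : x = 1 \/ exists k y, x = gn k * y.
Proof.
elim/posbraid_ind: x => -[|k w]; [by left|right; exists k, (posbraid_of w)].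
by rewrite -posbraid_ofM.
Qed.

Lemma posbraid_tail x : x = 1 \/ exists y k, x = y * gn k.
Proof.
elim/posbraid_ind: x; case/lastP => [|w k]; first by left.
by right; exists (posbraid_of w), k; rewrite posbraid_rcons.
Qed.

Definition is_lcm (a b l : posbraid) := [/\ posbraid_dvd a l, posbraid_dvd b l &
  forall y, posbraid_dvd a y -> posbraid_dvd b y -> posbraid_dvd l y].

(** The length of the common multiple [y] bounds the recursion. For $a=\sigma_i a'$ and $b=\sigma_j
    b'$, first take the lcm of $a'$ with the complement [lcm_cpl i j], which is this complement
    times some [c]; then the lcm [l2] of $b'$ with [lcm_cpl j i] times [c]. The lcm of [a] and [b]
    is $\sigma_j$ times [l2]. *)
Lemma lcm_exists a b y : posbraid_dvd a y -> posbraid_dvd b y ->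
  exists l, is_lcm a b l.
Proof.
have [n] := ubnP (pbsize y); elim: n => // n IH in a b y *; rewrite ltnS => yn.
case: (posbraid_head a) => [->|[i [a' ->]]].
  move=> _ _; exists b.
  by split=> //; [exists b; rewrite mul1g|exact: dvd_refl].
case: (posbraid_head b) => [-> _ _|[j [b' ->]]].
  exists (gn i * a'); split=> //; first exact: dvd_refl.
  by exists (gn i * a'); rewrite mul1g.
move=> [u yE] [v yE']; rewrite -!mulgA in yE yE'.
have [z [e1 e2]] := gn_head_split (etrans (esym yE) yE').
have y1n : (pbsize (a' * u)%g < n)%N.
  by move: yn; rewrite yE (pbsizeM (gn i)) pbsize_gn.
have y2n : (pbsize (b' * v)%g < n)%N.
  by move: yn; rewrite yE' (pbsizeM (gn j)) pbsize_gn.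
have a'u : posbraid_dvd a' (a' * u) by exists u.
have cu : posbraid_dvd (posbraid_of (lcm_cpl i j)) (a' * u) by exists z.
have [l1 [al1 [c l1E] l1P]] := IH _ _ _ y1n a'u cu; subst l1.
have [t zt] := l1P _ a'u cu.
have zE : z = c * t.
  apply: (posbraid_lcancel (a := posbraid_of (lcm_cpl i j))).
  by rewrite mulgA -zt; exact: esym e1.
have b'v : posbraid_dvd b' (b' * v) by exists v.
have cv : posbraid_dvd (mulw (lcm_cpl j i) c) (b' * v).
  by exists t; rewrite e2 zE /mulw mulgA.
have [l2 [bl2 cl2 l2P]] := IH _ _ _ y2n b'v cv.
exists (gn j * l2); split; last 2 first.
- exact/dvd_mul2l.
- move=> y' [u' y'E] [v' y'E']; rewrite -!mulgA in y'E y'E'.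
  have [z' [f1 f2]] := gn_head_split (etrans (esym y'E) y'E').
  rewrite y'E'; apply/dvd_mul2l/l2P; first by exists v'.
  rewrite f2; apply/dvd_mul2l.
  have [||t' e] := l1P (a' * u'); [by exists u'|by exists z'|].
  exists t'; apply: (posbraid_lcancel (a := posbraid_of (lcm_cpl i j))).
  by rewrite mulgA -e; exact: esym f1.
apply: dvd_trans (_ : posbraid_dvd _ (gn j * mulw (lcm_cpl j i) c)) _.
  by rewrite -lcm_cplE; exact/dvd_mul2l.
exact/dvd_mul2l.
Qed.

(** The least common left multiple, that is the lcm for right divisibility. *)
Definition is_llcm (a b l : posbraid) := [/\ rdvd a l, rdvd b l &
  forall y, rdvd a y -> rdvd b y -> rdvd l y].

Lemma llcm_exists a b y : rdvd a y -> rdvd b y -> exists l, is_llcm a b l.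
Proof.
move=> /rdvd_rev ay /rdvd_rev b_y; have [l [al bl lP]] := lcm_exists ay b_y.
exists (revb l); split; try by apply/rdvd_rev; rewrite revbK.
move=> x /rdvd_rev ax /rdvd_rev bx; apply/rdvd_rev; rewrite revbK.
exact: lP.
Qed.

(** * Walks in the graph of $\mathrm{Div}(z)$ and comparability of its vertices *)

Definition edge (x : posbraid) (a : letter) (y : posbraid) : Prop :=
  if a.2 then y = x * gn a.1 else x = y * gn a.1.

(** Only the vertices reached after a letter are required to divide [z]; for the start this is a
    hypothesis of the lemmas. *)
Fixpoint walk (z x : posbraid) (w : seq letter) (y : posbraid) : Prop :=
  if w is a :: w' then exists x', [/\ Div z x', edge x a x' & walk z x' w' y]
  else x = y.

Lemma edge_flip x a y : edge x a y -> edge y (flip a) x.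
Proof. by rewrite /edge /=; case: a.2. Qed.

Lemma edge_braid x a y :
  edge x a y -> to_braid y = to_braid x * braid_of [:: a].
Proof.
case: a => k b; rewrite /edge; case: b => /= ->.
  by rewrite to_braidM to_braidE.
rewrite to_braidM to_braidE -mulgA.
have := braid_ofM [:: (k, true)] [:: (k, false)].
rewrite /= => <-; rewrite (_ : braid_of _ = 1) ?mulg1 //.
by apply/class_ofP; have := cong_mulwV [:: (k, true)].
Qed.

Lemma posbraid_of2 i j : posbraid_of [:: i; j] = gn i * gn j.
Proof. exact: (posbraid_ofM [:: i] [:: j]). Qed.

Section Walk.

Variable z : posbraid.
Implicit Types (x y t : posbraid) (w : seq letter) (a : letter).

Notation D := (Div z).

Lemma Div_prefix x t : D (x * t) -> D x.
Proof. exact: dvd_mulr. Qed.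

Lemma walk_cat x w w' y :
  walk z x (w ++ w') y <-> exists2 t, walk z x w t & walk z t w' y.
Proof.
elim: w x => [|a w IH] x /=; first by split=> [|[t <-]]; first by exists x.
split=> [[x' [Dx' e /IH[t]]]|[t [x' [Dx' e xt]] ty]].
  by exists t => //; exists x'.
by exists x'; split=> //; apply/IH; exists t.
Qed.

Lemma walk_Div x w y : D x -> walk z x w y -> D y.
Proof.
elim: w x => [|a w IH] x /= Dx; first by move=> <-.
by case=> x' [Dx' _]; exact: IH.
Qed.

Lemma walk_inv x w y : D x -> walk z x w y -> walk z y (inv_word w) x.
Proof.
elim: w x => [|a w IH] x Dx /=; first by move->.
case=> x' [Dx' e /(IH _ Dx') h].
rewrite /inv_word /= rev_cons -cats1; apply/walk_cat; exists x' => //.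
by exists x; split=> //; exact: edge_flip.
Qed.

Lemma walk_braid x w y : walk z x w y -> to_braid y = to_braid x * braid_of w.
Proof.
elim: w x => [|a w IH] x /=.
  by move->; rewrite (_ : braid_of _ = 1) ?mulg1.
case=> x' [_ /edge_braid e /IH ->].
by rewrite e -mulgA (braid_ofM [:: a] w).
Qed.

Lemma drawn_walk x w y : D x -> walk z x w y -> drawn z x w.
Proof.
move=> Dx xy v /prefixP[w' wE]; rewrite wE in xy.
have [t xt _] := (walk_cat _ _ _ _).1 xy.
by exists t; [exact: walk_Div xt|exact: walk_braid].
Qed.

(** On $\mathrm{Div}(z)$, [lew m] below is a preorder, [upw m] its strict part and [flat m] its
    equivalence; that the last two exclude each other comes from [upw_irrefl]. *)
Definition flat m x y :=
  exists2 w, walk z x w y & all (fun a => a.1 < m)%N w.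

Definition lew m x y := exists2 w, walk z x w y & lower_letters m w.

Definition upw m x y :=
  exists2 w, walk z x w y & lower_letters m w /\ (m, true) \in w.

Lemma flat_refl m x : flat m x x.
Proof. by exists [::]. Qed.

Lemma flat_trans m y x t : flat m x y -> flat m y t -> flat m x t.
Proof.
move=> [w xy hw] [w' yt hw']; exists (w ++ w'); last by rewrite all_cat hw.
by apply/walk_cat; exists y.
Qed.

Lemma flat_sym m x y : D x -> flat m x y -> flat m y x.
Proof.
move=> Dx [w xy hw]; exists (inv_word w); first exact: walk_inv.
by rewrite /inv_word all_rev all_map.
Qed.

Lemma flat_lew m x y : flat m x y -> lew m x y.
Proof.
by case=> w xy hw; exists w => //; apply: sub_all hw => a; rewrite /= => ->.
Qed.

Lemma upw_lew m x y : upw m x y -> lew m x y.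
Proof. by case=> w xy [hw _]; exists w. Qed.

Lemma lew_refl m x : lew m x x.
Proof. exact/flat_lew/flat_refl. Qed.

Lemma lew_trans m y x t : lew m x y -> lew m y t -> lew m x t.
Proof.
move=> [w xy hw] [w' yt hw']; exists (w ++ w').
  by apply/walk_cat; exists y.
by rewrite /lower_letters all_cat; apply/andP.
Qed.

Lemma upw_lew_trans m y x t : upw m x y -> lew m y t -> upw m x t.
Proof.
move=> [w xy [hw mw]] [w' yt hw']; exists (w ++ w').
  by apply/walk_cat; exists y.
by rewrite /lower_letters all_cat mem_cat mw; split=> //; apply/andP.
Qed.

Lemma lew_upw_trans m y x t : lew m x y -> upw m y t -> upw m x t.
Proof.
move=> [w xy hw] [w' yt [hw' mw]]; exists (w ++ w').
  by apply/walk_cat; exists y.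
by rewrite /lower_letters all_cat mem_cat mw orbT; split=> //; apply/andP.
Qed.

Lemma lewP m x y : lew m x y -> flat m x y \/ upw m x y.
Proof.
case=> w xy hw; case mw : ((m, true) \in w); [by right; exists w|left].
exists w => //; apply/allP => a aw; have /orP[//|/eqP am] := allP hw a aw.
by rewrite -am aw in mw.
Qed.

Lemma upw_irrefl m x : ~ upw m x x.
Proof.
case=> w /walk_braid xx [hw mw]; apply: (sigma_positive_neq1 hw mw).
by apply: (mulgI (to_braid x)); rewrite -xx mulg1.
Qed.

Lemma lew_edge m x : D (x * gn m) -> upw m x (x * gn m).
Proof.
move=> Dxm; exists [:: (m, true)]; first by exists (x * gn m).
by rewrite /lower_letters /= eqxx orbT inE.
Qed.

Lemma flat_edge m k x : (k < m)%N -> D (x * gn k) -> flat m x (x * gn k).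
Proof.
move=> km Dxk; exists [:: (k, true)]; last by rewrite /= km.
by exists (x * gn k).
Qed.

Lemma flat_edgeV m k x : (k < m)%N -> D x -> flat m (x * gn k) x.
Proof.
move=> km Dxk; exists [:: (k, false)]; last by rewrite /= km.
by exists x.
Qed.

Lemma Div_lcm_gn x i j : D (x * gn i) -> D (x * gn j) ->
  D (x * gn i * posbraid_of (lcm_cpl i j)).
Proof.
move=> [u zE] [v zE']; have e := etrans (esym zE) zE'.
rewrite -!mulgA in e; have [t [uE _]] := gn_head_split (posbraid_lcancel e).
by exists t; rewrite zE uE /mulw !mulgA.
Qed.

Lemma gn_farr i j x : far i j -> x * gn i * gn j = x * gn j * gn i.
Proof.
move=> ij; rewrite -!mulgA; congr (_ * _).
by have := gn_far 1 ij; rewrite !mulg1.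
Qed.

Lemma gn_nearr i j x : near i j ->
  x * gn i * gn j * gn i = x * gn j * gn i * gn j.
Proof.
move=> ij; rewrite -!mulgA; congr (_ * _).
by have := gn_near 1 ij; rewrite !mulg1.
Qed.

Lemma lcm_cpl_far i j : far i j -> lcm_cpl i j = [:: j].
Proof. by rewrite /lcm_cpl; case: gen_cmpP. Qed.

Lemma lcm_cpl_near i j : near i j -> lcm_cpl i j = [:: j; i].
Proof. by rewrite /lcm_cpl; case: gen_cmpP. Qed.

(* Pushing sigma_(m+1) along a walk that is sigma_m-positive: the handle
   sigma_(m+1)^-1 sigma_m sigma_(m+1) becomes sigma_m sigma_(m+1) sigma_m^-1,
   and the detour stays in Div z because Div z has conditional lcm's. *)
Lemma lew_push m x y : D x -> lew m x y -> D (x * gn m.+1) ->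
  D (y * gn m.+1) /\ lew m.+1 (x * gn m.+1) (y * gn m.+1).
Proof.
move=> + [w]; elim: w x => [|a w IH] x Dx /=.
  by move=> -> _ Dy; split=> //; exact: lew_refl.
case=> x' [Dx' e x'y] /andP[am hw] Dxm.
suff [Dx'm xx'] : D (x' * gn m.+1) /\ lew m.+1 (x * gn m.+1) (x' * gn m.+1).
  by have [Dym] := IH _ Dx' x'y hw Dx'm; split=> //; exact: lew_trans xx' _.
case: a am e {x'y IH hw} => k b /= am.
have mm : near m.+1 m by rewrite /near eqxx orbT.
case/orP: am => [km|/eqP[-> ->]] e; last first.
  have xE : x' = x * gn m by [].
  rewrite xE in Dx' *; have := Div_lcm_gn Dxm Dx'.
  rewrite (lcm_cpl_near mm) posbraid_of2 mulgA => D1.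
  have mlt : (m < m.+1)%N by [].
  split; first by rewrite gn_nearr // in D1; exact: Div_prefix D1.
  apply: lew_trans (_ : lew m.+1 _ (x * gn m.+1 * gn m)) _.
    by apply/flat_lew/flat_edge => //; exact: Div_prefix D1.
  apply: lew_trans (upw_lew (lew_edge D1)) _; rewrite gn_nearr // in D1 *.
  by apply/flat_lew/flat_edgeV => //; exact: Div_prefix D1.
have far_k : far k m.+1 by rewrite /far; lia.
have far_k' : far m.+1 k by rewrite farC.
case: b e => /= xE.
  rewrite xE in Dx' *; have := Div_lcm_gn Dxm Dx'.
  rewrite (lcm_cpl_far far_k') => D1.
  rewrite -(gn_farr x far_k'); split=> //; apply/flat_lew/flat_edge => //.
  exact: ltnW.
rewrite xE (gn_farr _ far_k) in Dxm *; split; first exact: Div_prefix Dxm.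
by apply/flat_lew/flat_edgeV; [exact: ltnW|exact: Div_prefix Dxm].
Qed.

(** Mirror image of [lew_push], read from the end of the walk. With $\sigma_k$ for the letter [k],
    $x\sigma_m=p\,\sigma_{m+1}$ forces $x=t\sigma_m\sigma_{m+1}$ and $p=t\sigma_{m+1}\sigma_m$; then
    $t\sigma_m$ is joined to $p$ through $t$ and $t\sigma_{m+1}$, which are prefixes of known
    vertices and so stay in $\mathrm{Div}(z)$. *)
Lemma lew_pull m x y' : D x -> lew m x (y' * gn m.+1) ->
  exists2 x', x = x' * gn m.+1 & lew m.+1 x' y'.
Proof.
move=> + [w]; elim: w x => [|a w IH] x Dx /=.
  by move=> -> _; exists y' => //; exact: lew_refl.
case=> x1 [Dx1 e x1y] /andP[am hw].
have [p1 x1E p1y] := IH _ Dx1 x1y hw.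
suff [x' xE x'p1] : exists2 x', x = x' * gn m.+1 & lew m.+1 x' p1.
  by exists x' => //; exact: lew_trans x'p1 _.
case: a am e {x1y IH hw} => k b /= am.
have mm : near m m.+1 by rewrite /near eqxx.
have mm' : near m.+1 m by rewrite nearC.
case/orP: am => [km|/eqP[-> ->]] e; last first.
  have xE : x * gn m = p1 * gn m.+1 by rewrite -x1E.
  have [t [e1 e2]] := gn_tail_split xE.
  rewrite (lcm_cpl_near mm) (lcm_cpl_near mm') /rev /= in e1 e2.
  rewrite posbraid_of2 mulgA in e1.
  rewrite posbraid_of2 mulgA in e2.
  exists (t * gn m) => //; rewrite e2.
  have D1 : D (t * gn m.+1 * gn m).
    by rewrite -e2; rewrite x1E in Dx1; exact: Div_prefix Dx1.
  apply: lew_trans (_ : lew m.+1 _ t) _.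
    apply/flat_lew/flat_edgeV => //.
    by rewrite e1 -mulgA in Dx; exact: Div_prefix Dx.
  apply: lew_trans (upw_lew (lew_edge (Div_prefix D1))) _.
  exact/flat_lew/flat_edge.
have far_k : far k m.+1 by rewrite /far; lia.
have far_k' : far m.+1 k by rewrite farC.
case: b e => /= xE; rewrite x1E in xE Dx1.
  have [t [e1 e2]] := gn_tail_split (esym xE).
  rewrite lcm_cpl_far // in e1; rewrite lcm_cpl_far // in e2.
  exists t => //; rewrite e2; apply/flat_lew/flat_edge; first exact: ltnW.
  by have := Div_prefix Dx1; rewrite e2.
rewrite xE (gn_farr _ far_k'); exists (p1 * gn k) => //.
by apply/flat_lew/flat_edgeV; [exact: ltnW|exact: Div_prefix Dx1].
Qed.


Lemma lew_first m x y : lew m x y ->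
  flat m x y \/
  exists x1, [/\ flat m x x1, D (x1 * gn m) & lew m (x1 * gn m) y].
Proof.
case=> w; elim: w x => [|a w IH] x /=.
  by move=> <- _; left; exact: flat_refl.
case=> x' [Dx' e x'y] /andP[am hw].
case/orP: am => [am|/eqP aE]; last first.
  rewrite aE /edge /= in e; right; exists x; rewrite -e; split=> //.
    exact: flat_refl.
  by exists w.
have xx' : flat m x x' by exists [:: a]; [exists x'|rewrite /= am].
case: (IH _ x'y hw) => [x'y'|[x1 [x'x1 Dx1 x1y]]].
  by left; exact: flat_trans x'y'.
by right; exists x1; split=> //; exact: flat_trans x'x1.
Qed.

Lemma lew_last m x y : D x -> lew m x y ->
  flat m x y \/
  exists x1, [/\ lew m x x1, D (x1 * gn m) & flat m (x1 * gn m) y].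
Proof.
move=> + [w]; elim: w x => [|a w IH] x Dx /=.
  by move=> <- _; left; exact: flat_refl.
case=> x' [Dx' e x'y] /andP[am hw].
have xx' : lew m x x'.
  by exists [:: a]; [exists x'|rewrite /lower_letters /= am].
case: (IH _ Dx' x'y hw) => [x'y'|[x1 [x'x1 Dx1 x1y]]]; last first.
  by right; exists x1; split=> //; exact: lew_trans x'x1.
case/orP: am => [am|/eqP aE]; last first.
  rewrite aE /edge /= in e; right; exists x; rewrite -e; split=> //.
  exact: lew_refl.
by left; apply: flat_trans x'y'; exists [:: a]; [exists x'|rewrite /= am].
Qed.

Definition lew_total m := forall x y, D x -> D y -> flat m.+1 x y ->
  lew m x y \/ lew m y x.

(* An enumeration of Div z turns the acyclicity of [upw] into termination. *)
Variable L : seq posbraid.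
Hypothesis DL : forall x, D x -> x \in L.

Lemma count_lt (P Q : posbraid -> Prop) x : D x -> Q x -> ~ P x ->
  (forall t, P t -> Q t) ->
  (count (fun t => `[< P t >]) L < count (fun t => `[< Q t >]) L)%N.
Proof.
move=> /DL xL Qx Px PQ.
have /perm_to_rem/permP LE := xL; rewrite !LE /= asboolF // asboolT //.
rewrite add0n add1n ltnS; apply: sub_count => t /asboolP Pt.
by apply/asboolP; exact: PQ.
Qed.

Section Total.

Variable m : nat.
Hypothesis push : forall x y, flat m x y -> D x -> D (x * gn m) ->
  D (y * gn m) -> lew m (x * gn m) (y * gn m) \/ lew m (y * gn m) (x * gn m).
Hypothesis pull : forall x y, flat m (x * gn m) (y * gn m) ->
  D (x * gn m) -> D (y * gn m) -> lew m x y \/ lew m y x.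

(** Confluence: the first edges [m] of the two walks have sources in one flat class, so [push]
    compares their targets. The lower target is below both [y] and [y'] and has fewer vertices
    strictly above it than [x]. *)
Lemma lew_up_chain x y y' : D x -> lew m x y -> lew m x y' ->
  lew m y y' \/ lew m y' y.
Proof.
have [n] := ubnP (count (fun t => `[< D t /\ upw m x t >]) L).
elim: n => // n IH in x y y' *; rewrite ltnS => xn Dx xy xy'.
case: (lew_first xy) => [/(flat_sym Dx)/flat_lew yx|[x1 [xx1 Dx2 x2y]]].
  by left; exact: lew_trans xy'.
case: (lew_first xy') => [/(flat_sym Dx)/flat_lew yx|[x1' [xx1' Dx2' x2y']]].
  by right; exact: lew_trans xy.
have x11' := flat_trans (flat_sym Dx xx1) xx1'.
wlog {x11'} h : x1 x1' y y' xx1 xx1' Dx2 Dx2' x2y x2y' xy xy' /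
    lew m (x1 * gn m) (x1' * gn m).
  move=> H; case: (push x11' (Div_prefix Dx2) Dx2 Dx2') => h.
    exact: (H x1 x1').
  by apply/or_comm; exact: (H x1' x1).
apply: (IH (x1 * gn m)) => //; last exact: lew_trans x2y'.
apply: leq_trans xn; have xx2 : upw m x (x1 * gn m).
  exact: lew_upw_trans (flat_lew xx1) (lew_edge Dx2).
apply: (count_lt Dx2) => // [[_ /upw_irrefl]//|t [Dt x2t]].
by split=> //; exact: upw_lew_trans xx2 (upw_lew x2t).
Qed.

(** Dual to [lew_up_chain]: the last edges [m] are compared by [pull], and the higher of their two
    sources replaces [x]. *)
Lemma lew_down_chain x y y' : D x -> D y -> D y' -> lew m y x -> lew m y' x ->
  lew m y y' \/ lew m y' y.
Proof.
have [n] := ubnP (count (fun t => `[< D t /\ upw m t x >]) L).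
elim: n => // n IH in x y y' *; rewrite ltnS => xn Dx Dy Dy' yx y'x.
case: (lew_last Dy yx) => [/(flat_sym Dy)/flat_lew xy|[x1 [yx1 Dx1 x1x]]].
  by right; exact: lew_trans xy.
case: (lew_last Dy' y'x) =>
  [/(flat_sym Dy')/flat_lew xy|[x1' [yx1' Dx1' x1x']]].
  by left; exact: lew_trans xy.
have x11' := flat_trans x1x (flat_sym Dx1' x1x').
wlog {x11'} h : x1 x1' y y' Dy Dy' yx y'x yx1 yx1' Dx1 Dx1' x1x x1x' /
    lew m x1 x1'.
  move=> H; case: (pull x11' Dx1 Dx1') => h; first exact: (H x1 x1').
  by apply/or_comm; exact: (H x1' x1).
apply: (IH x1') => //; [|exact: Div_prefix Dx1'|exact: lew_trans yx1 h].
apply: leq_trans xn; have x1'x : upw m x1' x.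
  exact: upw_lew_trans (lew_edge Dx1') (flat_lew x1x').
apply: (count_lt (Div_prefix Dx1')) => //.
- by split=> //; exact: Div_prefix Dx1'.
- by case=> _ /upw_irrefl.
by move=> t [Dt tx1]; split=> //; exact: upw_lew_trans tx1 (upw_lew x1'x).
Qed.

(** Each letter of the walk from [x] to [y] is itself a comparison between neighbours; the two chain
    lemmas treat the case where it does not compose with the comparison already obtained. *)
Lemma lew_total_step : lew_total m.
Proof.
move=> x y Dx Dy [w]; elim: w x Dx => [|a w IH] x Dx /=.
  by move=> <- _; left; exact: lew_refl.
case=> x' [Dx' e x'y] /andP[am hw]; have := IH _ Dx' x'y hw.
case: a e am => k b; rewrite /= ltnS leq_eqVlt => e.
case/orP=> [/eqP km|km]; last first.
  have xx' : flat m x x'.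
    by exists [:: (k, b)]; [exists x'|rewrite /= km].
  have x'x := flat_sym Dx xx'.
  by case=> h; [left|right]; apply: lew_trans h _ || apply: lew_trans _ h;
    exact: flat_lew.
case: b e => /=; rewrite /edge /= km => e.
  have xx' : lew m x x' by rewrite e; apply/upw_lew/lew_edge; rewrite -e.
  case=> h; first by left; exact: lew_trans h.
  exact: (lew_down_chain Dx').
have xx' : lew m x' x by rewrite e; apply/upw_lew/lew_edge; rewrite -e.
case=> h; first exact: (lew_up_chain Dx').
by right; exact: lew_trans xx'.
Qed.

End Total.

(* Relative form of the comparison property of the sigma-ordering: the words
   witnessing it can be drawn inside Div z. *)
Lemma lew_totalP m : lew_total m.
Proof.
elim: m => [|m IH].
  (* No letter is below 0, so [flat 0] is equality and [pull] reduces to right cancellation. *)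
  apply: lew_total_step => x y [[|a w]]; rewrite ?andbF //=.
    by move=> -> *; left; exact: lew_refl.
  by move=> /posbraid_rcancel -> *; left; exact: lew_refl.
apply: lew_total_step => x y xy.
  move=> Dx Dxm Dym; case: (IH x y Dx (Div_prefix Dym) xy) => h.
    by left; have [] := lew_push Dx h Dxm.
  by right; have [] := lew_push (Div_prefix Dym) h Dym.
move=> Dxm Dym; case: (IH _ _ Dxm Dym xy) => h.
  by have [x' /posbraid_rcancel -> h'] := lew_pull Dxm h; left.
by have [x' /posbraid_rcancel -> h'] := lew_pull Dym h; right.
Qed.

(** When the comparison at the top level is not strict, both vertices lie in one flat class of the
    level below, where the argument is repeated. *)
Lemma flat_comparable r n x y : (r <= n)%N -> D x -> D y -> flat n x y ->
  flat r x y \/ exists2 m, (r <= m < n)%N & upw m x y \/ upw m y x.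
Proof.
move=> + Dx Dy; elim: n => [|n IH] rn xy.
  by left; move: rn; rewrite leqn0 => /eqP ->.
move: rn; rewrite leq_eqVlt => /orP[/eqP ->|]; first by left.
rewrite ltnS => rn; have [/lewP h|/lewP h] := lew_totalP Dx Dy xy.
  case: h => [h|h]; last by right; exists n; [rewrite rn /=|left].
  by case: (IH rn h) => [|[m mn u]]; [left|right; exists m => //; lia].
case: h => [/(flat_sym Dy) h|h]; last by right; exists n; [rewrite rn /=|right].
by case: (IH rn h) => [|[m mn u]]; [left|right; exists m => //; lia].
Qed.

End Walk.

(** * Heads of cosets, and their relation to the order *)

Definition is_head (r : nat) (x : posbraid) :=
  forall i, (i < r)%N -> ~ rdvd (gn i) x.

Definition head_of (r : nat) (x h : posbraid) :=
  is_head r h /\ exists2 u, all (fun k => k < r)%N u & x = h * posbraid_of u.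

Lemma head_exists r x : exists h, head_of r x h.
Proof.
have [n] := ubnP (pbsize x); elim: n => // n IH in x *; rewrite ltnS => xn.
case: (pselect (is_head r x)) =>
  [hx|/existsNP[i /not_implyP[ir /contrapT[y xE]]]].
  by exists x; split=> //; exists [::] => //; rewrite mulg1.
have yn : (pbsize y < n)%N by move: xn; rewrite xE pbsizeM pbsize_gn; lia.
have [h [hh [u hu yE]]] := IH _ yn; exists h; split=> //.
exists (rcons u i); first by rewrite all_rcons ir.
by rewrite posbraid_rcons mulgA -yE.
Qed.

Lemma all_lcm_cpl r i j : (i < r)%N -> (j < r)%N ->
  all (fun k => k < r)%N (rev (lcm_cpl i j)).
Proof.
move=> ir jr; rewrite all_rev /lcm_cpl.
by do 2?case: ifP => _ //=; rewrite ?ir ?jr.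
Qed.

(** Removing right letters below [r] is confluent: after two different removals, the remaining
    letters of the common left multiple can be removed too, since [lcm_cpl i j] only involves [i]
    and [j]. *)
Lemma head_unique r x h h' : head_of r x h -> head_of r x h' -> h = h'.
Proof.
have [n] := ubnP (pbsize x); elim: n => // n IH in x h h' *; rewrite ltnS => xn.
move=> [hh [u hu xE]] [hh' [u' hu' xE']].
case/lastP: u => [|u i] in hu xE.
  case/lastP: u' => [|u' j] in hu' xE'.
    by rewrite -(mulg1 h) -(mulg1 h') -xE.
  case: (hh j); first by move: hu'; rewrite all_rcons => /andP[].
  by exists (h' * posbraid_of u'); rewrite -mulgA -posbraid_rcons -xE' xE mulg1.
case/lastP: u' => [|u' j] in hu' xE'.
  case: (hh' i); first by move: hu; rewrite all_rcons => /andP[].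
  by exists (h * posbraid_of u); rewrite -mulgA -posbraid_rcons -xE xE' mulg1.
move: hu hu'; rewrite !all_rcons => /andP[ir hu] /andP[jr hu'].
rewrite posbraid_rcons mulgA in xE; rewrite posbraid_rcons mulgA in xE'.
have [t [e1 e2]] := gn_tail_split (etrans (esym xE) xE').
have [h0 [hh0 [v hv tE]]] := head_exists r t.
have n1 : (pbsize (h * posbraid_of u)%g < n)%N.
  by move: xn; rewrite xE (pbsizeM _ (gn i)) pbsize_gn addn1.
have n2 : (pbsize (h' * posbraid_of u')%g < n)%N.
  by move: xn; rewrite xE' (pbsizeM _ (gn j)) pbsize_gn addn1.
transitivity h0.
  apply: (IH _ _ _ n1); first by split=> //; exists u.
  split=> //; exists (v ++ rev (lcm_cpl i j)).
    by rewrite all_cat hv all_lcm_cpl.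
  by rewrite e1 tE posbraid_ofM mulgA.
apply/esym; apply: (IH _ _ _ n2); first by split=> //; exists u'.
split=> //; exists (v ++ rev (lcm_cpl j i)).
  by rewrite all_cat hv all_lcm_cpl.
by rewrite e2 tE posbraid_ofM mulgA.
Qed.

Lemma head_of_mulr r x h i :
  (i < r)%N -> head_of r x h -> head_of r (x * gn i) h.
Proof.
move=> ir [hh [u hu xE]]; split=> //; exists (rcons u i).
  by rewrite all_rcons ir.
by rewrite posbraid_rcons mulgA -xE.
Qed.

Lemma flat_head z r x y h : flat z r x y -> head_of r x h -> head_of r y h.
Proof.
case=> w; elim: w x => [|a w IH] x /=; first by move=> <-.
case=> x' [_ e x'y] /andP[ar hw] hx; apply: IH x'y hw _.
case: a e ar => k [] /= e kr; first by rewrite e; exact: head_of_mulr.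
have [h' hx'] := head_exists r x'.
rewrite e in hx; have := head_of_mulr kr hx'.
by move/(head_unique hx) => ->.
Qed.

Lemma posbraid_main_mul x y :
  posbraid_main (x * y) = maxn (posbraid_main x) (posbraid_main y).
Proof.
elim/posbraid_ind: x => u; elim/posbraid_ind: y => v.
by rewrite -posbraid_ofM !posbraid_mainE /pos_main_index big_cat.
Qed.

Lemma posbraid_main_letters N w : (posbraid_main (posbraid_of w) <= N)%N =
  all (fun k => k < N)%N w.
Proof.
rewrite posbraid_mainE /pos_main_index; elim: w => [|k w IH].
  by rewrite big_nil.
by rewrite big_cons geq_max IH.
Qed.

Lemma Div_main z x : Div z x -> (posbraid_main x <= posbraid_main z)%N.
Proof. by move=> [t ->]; rewrite posbraid_main_mul leq_maxl. Qed.

Lemma Div_connected z x y : Div z x -> Div z y -> flat z (posbraid_main z) x y.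
Proof.
suff H t : Div z t -> flat z (posbraid_main z) 1 t.
  move=> Dx Dy; apply: flat_trans (H _ Dy); apply: flat_sym (H _ Dx).
  by exists z; rewrite mul1g.
move=> Dt; have := Div_main Dt; elim/posbraid_ind: t Dt => u.
rewrite posbraid_main_letters; elim/last_ind: u => [|u i IH] Dx.
  by move=> _; exact: flat_refl.
rewrite posbraid_rcons in Dx *; rewrite all_rcons => /andP[ir hu].
apply: flat_trans (IH (Div_prefix Dx) hu) _; exact: flat_edge.
Qed.

Lemma lower_letters_cat m u v :
  lower_letters m (u ++ v) = lower_letters m u && lower_letters m v.
Proof. exact: all_cat. Qed.

Lemma lower_letters_pos m u : all (fun k => k < m)%N u ->
  lower_letters m (pos_word u) && lower_letters m (inv_word (pos_word u)).
Proof.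
move=> hu; rewrite /lower_letters /inv_word all_rev !all_map.
by apply/andP; split; apply: sub_all hu => k /= ->.
Qed.

Lemma lower_letters_main m w : lower_letters m w -> (m, true) \in w ->
  main_index w = m.+1 /\ sigma_positive w.
Proof.
move=> hw mw.
have E : main_index w = m.+1.
  apply/eqP; rewrite eqn_leq /main_index; apply/andP; split.
    apply/bigmax_leqP_seq => a aw _; have := allP hw a aw.
    by case/orP => [|/eqP ->] //; rewrite /gen_index => /ltnW.
  exact: (@leq_bigmax_seq _ w predT (fun a => gen_index a.1) (m, true)).
split=> //; rewrite /sigma_positive E; split.
  by rewrite -has_count; apply/hasP; exists (m, true) => //=; rewrite eqxx.
apply/eqP; rewrite -leqn0 leqNgt -has_count; apply/hasP => -[[k b] /= aw].
rewrite /gen_index eqSS => /andP[/eqP km /negbTE bE]; rewrite km bE in aw.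
by have /orP[] := allP hw _ aw; rewrite /= ?ltnn ?xpair_eqE ?andbF.
Qed.

Lemma sigma_positive_lower w : sigma_positive w ->
  exists m, [/\ main_index w = m.+1, lower_letters m w & (m, true) \in w].
Proof.
case; case E : (main_index w) => [|m].
  by rewrite -has_count => /hasP[a] /=.
rewrite -has_count => /hasP[[k b] /= aw]; rewrite /gen_index eqSS.
case/andP=> /eqP km bE /eqP; rewrite km bE in aw.
rewrite -leqn0 leqNgt -has_count => /hasPn hn; exists m; split=> //.
apply/allP => -[l c] lw /=; move/bigmax_leqP_seq: (leqnn (main_index w)).
rewrite E => /(_ _ lw isT); rewrite /gen_index /= leq_eqVlt ltnS eqSS.
have := hn _ lw; rewrite /= /gen_index eqSS; case: eqP => [->|_] /=.
  by rewrite negbK => ->; rewrite eqxx orbT.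
by move=> _ ->.
Qed.

Lemma braid_ltP r x y : braid_lt r.+1 x y <-> exists m w,
  [/\ (r <= m)%N, lower_letters m w, (m, true) \in w
    & to_braid y = to_braid x * braid_of w].
Proof.
split=> [[w [wE /sigma_positive_lower[m [mE hw mw]] rm]]|[m [w [rm hw mw e]]]].
  exists m, w; split=> //; first by rewrite mE in rm.
  by rewrite wE mulgA mulgV mul1g.
have [mE sw] := lower_letters_main hw mw.
by exists w; split=> //; [rewrite e mulgA mulVg mul1g|rewrite mE].
Qed.

(** With a common head, closing [w] by the two tails [v] and [u] would give a sigma-positive word
    representing 1. *)
Lemma braid_lt_head r x y h : braid_lt r.+1 x y -> head_of r x h ->
  ~ head_of r y h.
Proof.
move=> /braid_ltP[m [w [rm hw mw e]]] [_ [u hu xE]] [_ [v hv yE]].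
have lt_m k : (k < r)%N -> (k < m)%N by move/leq_trans; apply.
have /lower_letters_pos/andP[hu1 _] := sub_all lt_m hu.
have /lower_letters_pos/andP[_ hv2] := sub_all lt_m hv.
apply: (@sigma_positive_neq1 m (w ++ inv_word (pos_word v) ++ pos_word u)).
- by rewrite !lower_letters_cat hw hv2 hu1.
- by rewrite mem_cat mw.
apply: (mulgI (to_braid x)); rewrite !braid_ofM braid_ofV !mulgA -e mulg1.
by rewrite xE yE !to_braidM !to_braidE mulgK.
Qed.

Lemma maximumE (P : set nat) n : P n -> (forall k, P k -> (k <= n)%N) ->
  maximum P = n.
Proof.
move=> Pn nmax; rewrite /maximum; case: xgetP => [m _ [Pm mmax]|/(_ n)[]//].
by apply/eqP; rewrite eqn_leq nmax // mmax.
Qed.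

Lemma card_eq_seqP (C : set posbraid) n : (C #= `I_n)%card <->
  exists s : seq posbraid, [/\ uniq s, size s = n & forall x, C x <-> x \in s].
Proof.
elim: n C => [|n IH] C.
  rewrite II0 card_eq0; split=> [/eqP ->|[s [_ /size0nil -> Cs]]].
    by exists [::].
  by apply/eqP/seteqP; split=> // x /Cs.
split.
  case/eq_cardSP=> x Cx /IH[s [us ss Cs]].
  exists (x :: s); split=> /=; last 2 first.
  - by rewrite ss.
  - move=> y; rewrite inE; split=> [Cy|/orP[/eqP -> //|/Cs[]//]].
    by case: eqP => //= yx; apply/Cs.
  by rewrite us andbT; apply/negP => /Cs[_]; apply.
case=> -[|x s] [] //= /andP[xs us] [ss] Cs.
apply/eq_cardSP; exists x; first by apply/Cs; rewrite inE eqxx.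
apply/IH; exists s; split=> // y; rewrite /setD /=; split.
  by case=> /Cs; rewrite inE => /orP[/eqP|].
move=> ys; split; first by apply/Cs; rewrite inE ys orbT.
by move=> yx; move: xs; rewrite -yx ys.
Qed.

(** * Height and complexity as numbers of heads *)

Section Height.

Variables (z : posbraid) (L : seq posbraid).
Hypotheses (uL : uniq L) (DL : forall x, x \in L <-> Div z x).

Definition heads r := [seq x <- L | `[< is_head r x >]].

Lemma mem_heads r x : x \in heads r <-> Div z x /\ is_head r x.
Proof.
rewrite mem_filter; split=> [/andP[/asboolP hx /DL]|[/DL -> hx]] //.
by rewrite andbT; apply/asboolP.
Qed.

Lemma is_head_self r x : is_head r x -> head_of r x x.
Proof. by move=> hx; split=> //; exists [::]; rewrite ?mulg1. Qed.

Lemma Div_head r x h : Div z x -> head_of r x h -> h \in heads r.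
Proof.
move=> Dx [hh [u _ xE]]; apply/mem_heads; split=> //.
by rewrite xE in Dx; exact: Div_prefix Dx.
Qed.

Lemma heads_flat r x y : Div z x -> is_head r x -> is_head r y ->
  flat z r x y -> x = y.
Proof.
move=> Dx hx hy xy; apply: (@head_unique r y); last exact: is_head_self.
exact: flat_head xy (is_head_self hx).
Qed.

Lemma upw_braid_lt r m x y : (r <= m)%N -> upw z m x y -> braid_lt r.+1 x y.
Proof.
by move=> rm [w /walk_braid e [hw mw]]; apply/braid_ltP; exists m, w.
Qed.

Lemma height_heads r : (r <= posbraid_main z)%N ->
  height r.+1 z = size (heads r).
Proof.
move=> rz; apply: maximumE.
  exists (fun x => x \in heads r); split.
  - by move=> x /mem_heads[].
  - move=> x y /mem_heads[Dx hx] /mem_heads[Dy hy] xy.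
    have DL' t : Div z t -> t \in L by move/DL.
    case: (flat_comparable DL' rz Dx Dy (Div_connected Dx Dy)).
      by move/(heads_flat Dx hx hy).
    case=> m /andP[rm _] [u|u]; [left|right]; exact: upw_braid_lt u.
  by apply/card_eq_seqP; exists (heads r); split=> //; exact: filter_uniq.
move=> k [C [CD Cc /card_eq_seqP[s [us <- Cs]]]].
have hE x := projT2 (cid (head_exists r x)).
pose hd x := projT1 (cid (head_exists r x)).
(* Upper bound: by [braid_lt_head], taking heads is injective on a chain. *)
rewrite -(size_map hd); apply: uniq_leq_size.
  rewrite map_inj_in_uniq // => x y /Cs Cx /Cs Cy xy; apply: contrapT => nxy.
  case: (Cc x y Cx Cy nxy) => lt; apply: (braid_lt_head lt (hE _)).
    by rewrite -/(hd x) xy; exact: hE.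
  by rewrite -/(hd y) -xy; exact: hE.
move=> _ /mapP[x /Cs /CD Dx ->]; exact: Div_head Dx (hE x).
Qed.

Lemma is_head1 r : is_head r 1.
Proof.
by move=> i _ [x /(congr1 pbsize)]; rewrite pbsizeM pbsize_gn pbsize1 addn1.
Qed.

Lemma lower_letters_mono m n w : (m <= n)%N -> lower_letters m w ->
  lower_letters n w.
Proof.
move=> mn; apply: sub_all => a /orP[am|/eqP ->].
  by rewrite (leq_trans am).
by move: mn; rewrite leq_eqVlt => /orP[/eqP ->|->]; rewrite ?eqxx ?orbT.
Qed.

Section Complexity.

Variable m : nat.
Hypothesis zm : posbraid_main z = m.+1.

(** A comparison in the group, without a walk, as drawn words are given by the braids of their
    prefixes. The resulting [rank] serves the upper bound on the complexity; [rankw], built on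
    walks, serves the lower bound. *)
Definition above (g : braid) (h : posbraid) := exists w,
  [/\ lower_letters m w, (m, true) \in w & to_braid h = g * braid_of w].

Definition rank (g : braid) := count (fun h => `[< above g h >]) (heads m).

Lemma above_head x h : head_of m x h -> ~ above (to_braid x) h.
Proof.
move=> [_ [u hu xE]] [w [hw mw e]].
have /lower_letters_pos/andP[hu1 _] := hu.
apply: (@sigma_positive_neq1 m (w ++ pos_word u)).
- by rewrite lower_letters_cat hw.
- by rewrite mem_cat mw.
apply: (mulgI (to_braid x)); rewrite braid_ofM mulgA -e mulg1.
by rewrite xE to_braidM to_braidE.
Qed.

Lemma count_lt_size (T : eqType) (P : pred T) (s : seq T) x :
  x \in s -> ~~ P x -> (count P s < size s)%N.
Proof.
by move=> xs Px; rewrite -(count_predC P s) -[ltnLHS]addn0 ltn_add2l -has_count;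
  apply/hasP; exists x.
Qed.

Lemma rank_lt x : Div z x -> (rank (to_braid x) < size (heads m))%N.
Proof.
move=> Dx; have [h hx] := head_exists m x.
apply: (count_lt_size (Div_head Dx hx)); apply/asboolPn; exact: above_head.
Qed.

(** Each letter [(m, true)] costs one head: the head of the vertex it reaches is above the previous
    vertex, but not above the new one. The other letters do not increase the rank. *)
Lemma rank_drawn g w : lower_letters m w ->
  (forall v, prefix v w -> exists2 y, Div z y & to_braid y = g * braid_of v) ->
  (count_sigma m.+1 w + rank (g * braid_of w)%g <= rank g)%N.
Proof.
elim: w g => [|a w IH] g /=.
  by rewrite (_ : braid_of _ = 1) // mulg1.
case/andP=> am hw dr.
have -> : braid_of (a :: w) = braid_of [:: a] * braid_of w.
  exact: (braid_ofM [:: a] w).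
rewrite mulgA /count_sigma /= -addnA.
have le h : above (g * braid_of [:: a]) h -> above g h.
  move=> [v [hv mv e]]; exists (a :: v); split.
  - by rewrite /lower_letters /= am.
  - by rewrite inE mv orbT.
  - by rewrite e -mulgA -braid_ofM.
apply: (@leq_trans
  ((gen_index a.1 == m.+1) && a.2 + rank (g * braid_of [:: a])%g)%N).
  rewrite leq_add2l; apply: IH => // v vw.
  have [|y Dy e] := dr (a :: v); first by rewrite /= eqxx.
  by exists y; rewrite // e -mulgA -braid_ofM.
case/orP: am => [am|/eqP aE].
  have -> : (gen_index a.1 == m.+1) = false by rewrite /gen_index eqSS ltn_eqF.
  by apply: sub_count => h /asboolP/le h'; apply/asboolP.
rewrite aE /gen_index /= eqxx add1n -aE.
have [|y Dy e] := dr [:: a]; first by rewrite /= eqxx prefix0s.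
have [h hy] := head_exists m y.
rewrite /rank; have /perm_to_rem/permP E := Div_head Dy hy.
rewrite !E /= (asboolF (P := above (g * _) h)); last first.
  by rewrite -e; exact: above_head.
rewrite asboolT ?add0n ?add1n ?ltnS.
  by apply: sub_count => t /asboolP/le t'; apply/asboolP.
case: hy => _ [u /lower_letters_pos/andP[_ hu] yE].
exists (a :: inv_word (pos_word u)); split.
- by apply/andP; split=> //; rewrite aE eqxx orbT.
- by rewrite aE inE eqxx.
have -> : braid_of (a :: inv_word (pos_word u)) =
    braid_of [:: a] * (braid_of (pos_word u))^-1.
  by rewrite -braid_ofV -braid_ofM.
by rewrite mulgA -e yE to_braidM to_braidE mulgK.
Qed.

(** A main letter above [m] would separate the heads of the two ends, whereas at that level every
    divisor of [z] has head 1. *)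
Lemma drawn_lower x w : Div z x -> sigma_positive w -> drawn z x w ->
  lower_letters m w.
Proof.
move=> Dx /sigma_positive_lower[n [_ hw nw]] dr.
have [nm|mn] := leqP n m; first exact: lower_letters_mono hw.
have [y Dy e] := dr w (prefix_refl w).
have lt : braid_lt n.+1 x y by apply/braid_ltP; exists n, w.
have H t : Div z t -> head_of n t 1.
  move=> /Div_main; rewrite zm => tm; split; first exact: is_head1.
  exists (repr t); last by rewrite mul1g /posbraid_of class_of_repr.
  by rewrite -posbraid_main_letters /posbraid_of class_of_repr (leq_trans tm).
by case: (braid_lt_head lt (H _ Dx) (H _ Dy)).
Qed.

Definition rankw x := count (fun h => `[< upw z m x h >]) (heads m).

(** Go to a head [h] above [x] of maximal rank. Heads are pairwise comparable, and one lying between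
    [x] and [h] would have larger rank; so every other head above [x] is above [h], and the step to
    [h] loses only one head. *)
Lemma walk_rank x : Div z x -> exists w y,
  [/\ walk z x w y, lower_letters m w & (rankw x <= count_sigma m.+1 w)%N].
Proof.
have [n] := ubnP (rankw x); elim: n => // n IH in x *; rewrite ltnS => xn Dx.
case: (posnP (rankw x)) => [->|]; first by exists [::], x.
rewrite -has_count => /hasP[h0 h0h /asboolP xh0].
pose P k := `[< exists h, [/\ h \in heads m, upw z m x h & rankw h = k] >].
have exP : exists k, P k by exists (rankw h0); apply/asboolP; exists h0.
have ubP k : P k -> (k <= size (heads m))%N.
  by move=> /asboolP[h [_ _ <-]]; exact: count_size.
case: (ex_maxnP exP ubP) => k /asboolP[h [hh xh hk]] kmax.
have Dh : Div z h by have /mem_heads[] := hh.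
have hx : (rankw h < rankw x)%N.
  rewrite /rankw; have /perm_to_rem/permP E := hh.
  rewrite !E /= asboolF ?asboolT ?add0n ?add1n ?ltnS //; last exact: upw_irrefl.
  apply: sub_count => t /asboolP ht; apply/asboolP.
  exact: upw_lew_trans xh (upw_lew ht).
have xh1 : (rankw x <= (rankw h).+1)%N.
  pose b t := `[< upw z m h t >].
  have le : subpred (fun t => (t \in heads m) && `[< upw z m x t >])
      (predU (pred1 h) b).
    move=> t /andP[th /asboolP xt] /=; rewrite /b.
    case: eqVneq => //= nth; apply/asboolP.
    have /mem_heads[Dt ht] := th; have /mem_heads[_ hd] := hh.
    have DL' y : Div z y -> y \in L by move/DL.
    have zm' : (m <= posbraid_main z)%N by rewrite zm.
    have := Div_connected Dh Dt; rewrite zm.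
    case/(flat_comparable DL' (leqnSn m) Dh Dt).
      by move/(heads_flat Dh hd ht) => e; rewrite e eqxx in nth.
    case=> n' /andP[mn nm].
    have -> : n' = m by lia.
    case=> // hth.
    have := kmax (rankw t); rewrite -hk leqNgt /rankw => /(_ _)/negP[].
      by apply/asboolP; exists t.
    have /perm_to_rem/permP E := hh.
    rewrite !E /= asboolF ?asboolT ?add0n ?add1n ?ltnS //.
      2: exact: upw_irrefl.
    apply: sub_count => s /asboolP hs; apply/asboolP.
    exact: upw_lew_trans hth (upw_lew hs).
  rewrite /rankw.
  rewrite (eq_in_count (a2 := fun t => (t \in heads m) && `[< upw z m x t >])).
    apply: leq_trans (sub_count le _) _.
    apply: leq_trans (leq_addr (count (predI (pred1 h) b) (heads m)) _) _.
    rewrite count_predUI count_uniq_mem.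
      by rewrite hh add1n.
    exact: filter_uniq.
  by move=> t ->.
have [w [y [hy hw cw]]] := IH h (leq_trans hx xn) Dh.
case: (xh) => w' xh' [hw' mw']; exists (w' ++ w), y; split.
- by apply/walk_cat; exists h.
- by rewrite lower_letters_cat hw'.
rewrite /count_sigma count_cat; apply: leq_trans xh1 _.
rewrite -add1n leq_add //.
by rewrite -has_count; apply/hasP; exists (m, true); rewrite //= eqxx.
Qed.

(** Otherwise comparability gives a strict walk from [h] down to 1; followed by a positive word for
    [h], it would be a sigma-positive word representing 1. *)
Lemma upw1_head h : h \in heads m -> h != 1 -> upw z m 1 h.
Proof.
move=> /mem_heads[Dh hh] h1.
have D1 : Div z 1 by exists z; rewrite mul1g.
have DL' t : Div z t -> t \in L by move/DL.
have := Div_connected D1 Dh; rewrite zm.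
move/(flat_comparable DL' (leqnSn m) D1 Dh).
case=> [/(heads_flat D1 (@is_head1 m) hh) e|[n /andP[mn nm]]].
  by rewrite -e eqxx in h1.
have -> : n = m by lia.
case=> // -[w hw [low mw]].
have := Div_main Dh; rewrite zm -(class_of_repr h) -/(posbraid_of _).
rewrite posbraid_main_letters => hu.
case: (@sigma_positive_neq1 m (w ++ pos_word (repr h))).
- rewrite lower_letters_cat low /lower_letters all_map.
  by apply: sub_all hu => k /=; rewrite ltnS leq_eqVlt xpair_eqE andbT orbC.
- by rewrite mem_cat mw.
have := walk_braid hw; rewrite to_braid1 braid_ofM => e.
apply: (mulgI (to_braid h)); rewrite mulgA -e mul1g mulg1.
by rewrite -to_braidE /posbraid_of class_of_repr.
Qed.

Lemma complexity_heads : (1 < size (heads m))%N ->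
  height m.+1 z = (complexity z + 1)%N.
Proof.
move=> m1; rewrite height_heads ?zm //.
suff -> : complexity z = (size (heads m)).-1 by rewrite addn1 prednK // ltnW.
have D1 : Div z 1 by exists z; rewrite mul1g.
have max x w : Div z x -> sigma_positive w -> drawn z x w ->
    (count_sigma m.+1 w <= (size (heads m)).-1)%N.
  move=> Dx sw dr; have := rank_drawn (drawn_lower Dx sw dr) dr.
  move/(leq_trans (leq_addr _ _))/leq_ltn_trans/(_ (rank_lt Dx)).
  by case: (size _).
apply: maximumE => [|k [x [w [Dx sw dr ->]]]].
  2: by rewrite zm; exact: (max x).
have r1 : rankw 1 = (size (heads m)).-1.
  have h1 : 1 \in heads m by apply/mem_heads; split; last exact: is_head1.
  rewrite /rankw -(count_predC (pred1 1) (heads m)).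
  rewrite count_uniq_mem ?filter_uniq //.
  rewrite h1 add1n /=; apply: eq_in_count => h hh /=.
  case: eqVneq => [->|h0] /=; first by apply/asboolPn; exact: upw_irrefl.
  by apply/asboolP; exact: upw1_head.
have [w [y [wy hw cw]]] := walk_rank D1; rewrite r1 in cw.
(* A second head makes the count positive, so that the extremal word is sigma-positive. *)
have mw : (m, true) \in w.
  have : (0 < count_sigma m.+1 w)%N.
    by apply: leq_trans cw; rewrite -subn1 subn_gt0.
  rewrite -has_count => /hasP[[k b] kw /andP[/= /eqP [<-] be]].
  by rewrite be in kw.
have [_ sw] := lower_letters_main hw mw.
exists 1, w; split=> //; first exact: drawn_walk wy.
apply/eqP; rewrite eqn_leq zm cw (max 1) //; exact: drawn_walk wy.
Qed.

End Complexity.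

End Height.

(** * Right normal forms of the divisors of a power of $\Delta$ *)

Section NormalForm.

Variables (N : nat) (Dt : posbraid) (S : seq (seq gen)).
Variables (dl dr : seq gen -> gen -> bool).

Definition simple (x : posbraid) := rdvd x Dt.

(** The properties of $\Delta$ used for counting, chosen so that a finite computation decides them.
    By [gd_sqfree] and [gd_ext], $\sigma_i s$ is simple exactly when $\sigma_i$ does not already
    divide the simple braid $s$ on the left. *)
Record garside_data : Prop := GarsideData {
  gd_main : posbraid_main Dt = N;
  gd_simple : forall x, simple x <-> exists2 s, s \in S & x = posbraid_of s;
  gd_inj : {in S &, injective posbraid_of};
  gd_uniq : uniq S;
  gd_nil : [::] \in S;
  gd_dl : forall s i, s \in S -> (i < N)%N ->
    dl s i <-> posbraid_dvd (gn i) (posbraid_of s);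
  gd_dr : forall s i, s \in S -> (i < N)%N ->
    dr s i <-> rdvd (gn i) (posbraid_of s);
  gd_sqfree : forall i t, ~ simple (gn i * (gn i * t));
  gd_ext : forall i s, (i < N)%N -> simple s -> ~ posbraid_dvd (gn i) s ->
    simple (gn i * s);
  gd_ldvd : forall x, simple x <-> posbraid_dvd x Dt;
  gd_gn : forall i, (i < N)%N -> simple (gn i);
  gd_central : forall i, (i < N)%N -> exists j, gn i * Dt = Dt * gn j
}.

Hypothesis GD : garside_data.

Definition normal (x s : posbraid) :=
  forall i, rdvd (gn i) x -> posbraid_dvd (gn i) s.

Lemma rdvd_trans y x z : rdvd x y -> rdvd y z -> rdvd x z.
Proof. by move=> [t ->] [u ->]; exists (u * t); rewrite mulgA. Qed.

(** Let $cs$ be the least common left multiple of $s$ and $t$; it is simple. If $c\ne1$, its last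
    letter $\sigma_i$ also ends $x$, hence by normality begins $s$, and $cs$ would contain the
    square $\sigma_i\sigma_i$. *)
Lemma normal_max x s t : normal x s -> simple s -> simple t ->
  rdvd t (x * s) -> rdvd t s.
Proof.
move=> nxs ss st txs; have sxs : rdvd s (x * s) by exists x.
have [l [[c lE] tl lP]] := llcm_exists ss st.
have [e xsE] := lP _ sxs txs.
case: (posbraid_tail c) => [c1|[c' [i cE]]].
  by move: tl; rewrite lE c1 mul1g.
have xE : x = e * c' * gn i.
  by apply: (posbraid_rcancel (a := s)); rewrite xsE lE cE !mulgA.
have [|s' sE] := nxs i; first by exists (e * c').
case: (gd_sqfree GD (i := i) (t := s')).
apply: rdvd_trans (lP _ ss st); exists c'.
by rewrite lE cE sE !mulgA.
Qed.

Lemma simple_size x : simple x -> (pbsize x <= pbsize Dt)%N.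
Proof. by move=> [y ->]; rewrite pbsizeM leq_addl. Qed.

Lemma gn_main i : posbraid_main (gn i) = i.+1.
Proof. by rewrite posbraid_mainE /pos_main_index big_cons big_nil maxn0. Qed.

Lemma rdvd_gn_main i x : rdvd (gn i) x -> (i < posbraid_main x)%N.
Proof. by move=> [t ->]; rewrite posbraid_main_mul gn_main leq_maxr. Qed.

(** Take for [s] a longest simple right divisor: [gd_ext] makes it normal, and the lcm with [s0]
    shows that it absorbs [s0], so that [x] is a left divisor of [x0]. *)
Lemma normal_exists x0 s0 : simple s0 -> (posbraid_main (x0 * s0)%g <= N)%N ->
  exists x s, [/\ simple s, normal x s, x0 * s0 = x * s & posbraid_dvd x x0].
Proof.
move=> ss0 yN; set y := x0 * s0 in yN *.
pose P k := `[< exists s, [/\ simple s, rdvd s y & pbsize s = k] >].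
have exP : exists k, P k.
  by exists (pbsize s0); apply/asboolP; exists s0; split=> //; exists x0.
have ubP k : P k -> (k <= pbsize Dt)%N.
  by move=> /asboolP[s [/simple_size ? _ <-]].
case: (ex_maxnP exP ubP) => k /asboolP[s [ss [x yE] sk]] kmax.
have smax t : simple t -> rdvd t y -> (pbsize t <= pbsize s)%N.
  by move=> st ty; rewrite sk; apply: kmax; apply/asboolP; exists t.
exists x, s; split=> //.
- move=> i ix; have iN : (i < N)%N.
    apply: leq_trans (rdvd_gn_main ix) _.
    by apply: leq_trans yN; rewrite yE posbraid_main_mul leq_maxl.
  apply: contrapT => nis; have := smax _ (gd_ext GD iN ss nis).
  rewrite pbsizeM pbsize_gn ltnn; case: ix => x' xE.
  by have h : rdvd (gn i * s) y; [exists x'; rewrite yE xE mulgA|move/(_ h)].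
have s0y : rdvd s0 y by exists x0.
have sy : rdvd s y by exists x.
have [l [[c lE] [e lE'] lP]] := llcm_exists ss ss0.
have := smax l (lP _ ss ss0) (lP _ sy s0y).
rewrite lE pbsizeM => cs; have /pbsize_eq0 c1 : pbsize c = 0%N by lia.
rewrite c1 mul1g in lE; rewrite lE in lE'.
exists e; apply: (posbraid_rcancel (a := s0)).
by rewrite -/y yE lE' mulgA.
Qed.

Lemma central_mul x : (posbraid_main x <= N)%N -> exists y, x * Dt = Dt * y.
Proof.
elim/posbraid_ind: x => u; rewrite posbraid_main_letters; elim: u => [|i u IH].
  by exists 1; rewrite mulg1 mul1g.
case/andP=> iN /IH[y yE]; have [j jE] := gd_central GD iN; exists (gn j * y).
by rewrite -/(mulw _ _) mulw_cons /mulw yE mulgA jE mulgA.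
Qed.

(** Keeps all letters below [N], where [gd_ext], [gd_gn] and [gd_central] apply. *)
Lemma main_exp d : (posbraid_main (Dt ^+ d) <= N)%N.
Proof.
elim: d => [|d IH]; first by rewrite (posbraid_main_letters N [::]).
by rewrite expgS posbraid_main_mul geq_max IH (gd_main GD) leqnn.
Qed.

Lemma Div_expS d y : Div (Dt ^+ d.+1) y <->
  exists x s, [/\ Div (Dt ^+ d) x, simple s & y = x * s].
Proof.
split; last first.
  move=> [x [s [[x' xE] /(gd_ldvd GD)[t sE] ->]]].
  have [|x'' x''E] := @central_mul x'.
    by apply: leq_trans (main_exp d); rewrite xE posbraid_main_mul leq_maxr.
  exists (t * x''); rewrite expgSr xE -mulgA x''E {1}sE !mulgA.
  by [].
have ND x s : Div (Dt ^+ d) x -> simple s -> (posbraid_main (x * s)%g <= N)%N.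
  move=> /Div_main xN ss; rewrite posbraid_main_mul geq_max.
  rewrite (leq_trans xN) ?main_exp //=.
  by have /(gd_ldvd GD) /Div_main := ss; rewrite (gd_main GD).
case=> t; elim/posbraid_ind: t => w; elim: w y => [|i w IH] y yE.
  exists (Dt ^+ d), Dt; split; first exact: dvd_refl.
    by exists 1; rewrite mul1g.
  by rewrite -expgSr yE mulg1.
have [|x0 [s0 [Dx0 ss0 e0]]] := IH (y * gn i).
  by rewrite yE -/(mulw _ _) (posbraid_ofM [:: i] w) mulgA.
have yN := ND _ _ Dx0 ss0.
have [x [s [ss nxs e xx0]]] := normal_exists ss0 yN.
have iN : (i < N)%N.
  by apply: leq_trans (rdvd_gn_main _) yN; exists y.
have [|s' sE] := normal_max nxs ss (gd_gn GD iN).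
  by exists y; rewrite -e -e0.
exists x, s'; split.
- exact: dvd_trans xx0 Dx0.
- apply/(gd_ldvd GD); apply: (@dvd_mulr _ (gn i)); rewrite -sE.
  exact/(gd_ldvd GD).
by apply: (posbraid_rcancel (a := gn i)); rewrite e0 e sE mulgA.
Qed.

Definition compat (s t : seq gen) :=
  all (fun i => dr s i ==> dl t i) (iota 0 N).

(* The second component is the last factor of the right normal form of the
   first one; the condition on it is local. *)
Fixpoint nf_seq (d : nat) : seq (posbraid * seq gen) :=
  if d is d'.+1 then
    [seq (x.1 * posbraid_of t, t)
       | x <- nf_seq d', t <- [seq t <- S | compat x.2 t]]
  else [:: (1, [::])].

Lemma nf_seqS d y t : (y, t) \in nf_seq d.+1 <-> exists x s,
  [/\ (x, s) \in nf_seq d, t \in S, compat s t & y = x * posbraid_of t].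
Proof.
split=> [/allpairsPdep[[x s] [t' [xs]]]|[x [s [xs tS st ->]]]].
  by rewrite mem_filter => /andP[st tS] [-> ->]; exists x, s.
apply/allpairsPdep; exists (x, s), t; split=> //.
by rewrite mem_filter st tS.
Qed.

Lemma simple_mem s : s \in S -> simple (posbraid_of s).
Proof. by move=> sS; apply/(gd_simple GD); exists s. Qed.

Lemma rdvd_1 i : ~ rdvd (gn i) 1.
Proof. by apply: (@is_head1 i.+1). Qed.

(** By [normal_max] applied to single letters, the right descents of [x] are those of its last
    factor; this makes the normality condition local. *)
Lemma nf_seq_spec d x s : (x, s) \in nf_seq d ->
  [/\ s \in S, Div (Dt ^+ d) x
    & forall i, (i < N)%N -> dr s i <-> rdvd (gn i) x].
Proof.
elim: d x s => [|d IH] x s.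
  rewrite inE => /eqP[-> ->]; split; first exact: gd_nil GD.
    exact: dvd_refl.
  by move=> i iN; rewrite (gd_dr GD (gd_nil GD) iN).
move=> /nf_seqS[x' [s' [/IH[s'S Dx' H] sS s's ->]]]; split=> //.
  by apply/Div_expS; exists x', (posbraid_of s); split=> //; exact: simple_mem.
move=> i iN; rewrite (gd_dr GD sS iN); split.
  by case=> t ->; exists (x' * t); rewrite mulgA.
apply: normal_max (simple_mem sS) (gd_gn GD iN) => j jx.
have jN : (j < N)%N.
  apply: leq_trans (rdvd_gn_main jx) (leq_trans (Div_main Dx') (main_exp d)).
apply/(gd_dl GD sS jN); move/allP: s's => /(_ j); rewrite mem_iota add0n jN.
by move/(_ isT)/implyP; apply; apply/H.
Qed.

Lemma compat_normal d x s t : (x, s) \in nf_seq d -> t \in S ->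
  compat s t <-> normal x (posbraid_of t).
Proof.
move=> xs tS; have [sS Dx H] := nf_seq_spec xs; split=> [st j jx|nxt].
  have jN : (j < N)%N.
    apply: leq_trans (rdvd_gn_main jx) (leq_trans (Div_main Dx) (main_exp d)).
  apply/(gd_dl GD tS jN); move/allP: st => /(_ j); rewrite mem_iota add0n jN.
  by move/(_ isT)/implyP; apply; apply/H.
apply/allP => j; rewrite mem_iota add0n => /= jN; apply/implyP => /(H j jN) jx.
by apply/(gd_dl GD tS jN)/nxt.
Qed.

Lemma rdvd_anti x y : rdvd x y -> rdvd y x -> x = y.
Proof.
move=> [a yE] [b xE]; have := congr1 pbsize yE; have := congr1 pbsize xE.
rewrite !pbsizeM => e1 e2; have a1 : pbsize a = 0%N by lia.
by rewrite yE (pbsize_eq0 a1) mul1g.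
Qed.

Lemma normal_unique x s x' s' : normal x s -> normal x' s' -> simple s ->
  simple s' -> x * s = x' * s' -> x = x' /\ s = s'.
Proof.
move=> nxs nxs' ss ss' e.
have sE : s = s'.
  apply: rdvd_anti.
    by apply: (normal_max nxs' ss' ss); rewrite -e; exists x.
  by apply: (normal_max nxs ss ss'); rewrite e; exists x'.
by split=> //; rewrite sE in e; exact: posbraid_rcancel e.
Qed.

Lemma nf_seq_uniq d : uniq (map fst (nf_seq d)).
Proof.
suff H : uniq (nf_seq d) /\ {in nf_seq d &, injective fst}.
  by rewrite map_inj_in_uniq; case: H.
elim: d => [|d [uL inj]].
  by split=> // x y; rewrite !inE => /eqP -> /eqP ->.
have key x s t x' s' t' : (x, s) \in nf_seq d -> (x', s') \in nf_seq d ->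
    t \in S -> t' \in S -> compat s t -> compat s' t' ->
    x * posbraid_of t = x' * posbraid_of t' -> (x, s) = (x', s') /\ t = t'.
  move=> xs xs' tS tS' st st' e.
  have [||||xE /(gd_inj GD tS tS') tE] := normal_unique _ _ _ _ e.
  - by apply/(compat_normal xs tS).
  - by apply/(compat_normal xs' tS').
  - exact: simple_mem.
  - exact: simple_mem.
  by split=> //; apply: inj.
split.
  apply: allpairs_uniq_dep => //.
    by move=> x _; rewrite filter_uniq // (gd_uniq GD).
  move=> [[x s] t] [[x' s'] t'] /allpairsPdep[[a b] [c [ab cS [-> -> ->]]]].
  case/allpairsPdep=> [[a' b'] [c' [ab' cS' [-> -> ->]]]] [e _] /=.
  move: cS cS'; rewrite !mem_filter => /andP[bc cS] /andP[bc' cS'].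
  by have [-> ->] := key _ _ _ _ _ _ ab ab' cS cS' bc bc' e.
move=> [y t] [y' t'] /nf_seqS[x [s [xs tS st ->]]].
move=> /nf_seqS[x' [s' [xs' tS' st' ->]]] /= e.
by have [[-> _] ->] := key _ _ _ _ _ _ xs xs' tS tS' st st' e.
Qed.

Lemma mem_nf_seq d y : y \in map fst (nf_seq d) <-> Div (Dt ^+ d) y.
Proof.
split=> [/mapP[[x s] xs ->]|]; first by have [] := nf_seq_spec xs.
elim: d y => [|d IH] y.
  case=> t /(congr1 pbsize); rewrite pbsizeM pbsize1 => e.
  have /pbsize_eq0 -> : pbsize y = 0%N by lia.
  by rewrite /= inE.
move=> /Div_expS[x0 [s0 [Dx0 ss0 ->]]].
have yN : (posbraid_main (x0 * s0)%g <= N)%N.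
  rewrite posbraid_main_mul geq_max (leq_trans (Div_main Dx0) (main_exp d)) /=.
  by have /(gd_ldvd GD) /Div_main := ss0; rewrite (gd_main GD).
have [x [s [ss nxs e xx0]]] := normal_exists ss0 yN.
have /mapP[[x' s'] xs' /= xE] := IH x (dvd_trans xx0 Dx0); subst x'.
have [t tS tE] := (gd_simple GD s).1 ss; rewrite tE in nxs e.
apply/mapP; exists (x * posbraid_of t, t) => //.
by apply/nf_seqS; exists x, s'; split=> //; apply/(compat_normal xs' tS).
Qed.

Definition transfer (g : seq gen -> nat) (s : seq gen) : nat :=
  \sum_(t <- S | compat s t) g t.

Lemma sum_nf_seq d g :
  \sum_(x <- nf_seq d) g x.2 = iter d transfer g [::] :> nat.
Proof.
elim: d g => [|d IH] g; first by rewrite big_seq1.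
rewrite iterSr -IH /= big_allpairs_dep; apply: eq_bigr => x _ /=.
by rewrite big_filter.
Qed.

Definition head_word r (s : seq gen) : nat :=
  all (fun i => ~~ dr s i) (iota 0 r).

Lemma size_heads r d : (r <= N)%N ->
  size (heads (map fst (nf_seq d)) r) = iter d transfer (head_word r) [::].
Proof.
move=> rN; rewrite -sum_nf_seq /heads filter_map size_map size_filter.
rewrite -sum1_count big_mkcond big_seq [RHS]big_seq.
apply: eq_bigr => -[x s] xs /=; have [sS _ H] := nf_seq_spec xs.
rewrite /head_word (_ : asbool _ = all (fun i => ~~ dr s i) (iota 0 r)).
  by case: all.
apply/asboolP/allP => [hx i|hs i ir].
  rewrite mem_iota add0n => /= ir; apply/negP.
  by move/(H i (leq_trans ir rN)); exact: hx.
move/(H i (leq_trans ir rN)) => di; have := hs i.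
by rewrite mem_iota add0n /= ir di => /(_ isT).
Qed.

End NormalForm.

(** * Verification of the Garside data by computation on words *)

Fixpoint rewrites (w : seq gen) : seq (seq gen) :=
  if w is i :: t then
    [seq i :: t' | t' <- rewrites t] ++
    (if t is j :: q then
       (if far i j then [:: [:: j, i & q]] else [::]) ++
       (if q is k :: r then
          if near i j && (k == i) then [:: [:: j, i, j & r]] else [::]
        else [::])
     else [::])
  else [::].

Lemma rewrites_complete p u v q : braid_rel u v ->
  p ++ v ++ q \in rewrites (p ++ u ++ q).
Proof.
move=> uv; elim: p => [|i p IH] /=; last by rewrite mem_cat map_f.
case: uv => i j ij /=; rewrite mem_cat.
  have -> : far i j by []; by rewrite mem_cat inE eqxx orbT.
by have -> : near i j by []; rewrite eqxx /= mem_cat mem_seq1 eqxx !orbT.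
Qed.

Lemma rewrites_sound w v : v \in rewrites w -> cong braid_rel w v.
Proof.
elim: w v => //= i t IH v; rewrite mem_cat => /orP[/mapP[t' /IH tt' ->]|].
  have := cong_cat2 [:: i] [::] tt'; by rewrite !cats0.
case: t {IH} => // j q; rewrite mem_cat => /orP[].
  case: ifP => // ij; rewrite inE => /eqP ->.
  exact: (cong_step [::] q (braid_far ij)).
case: q => // k r; case: ifP => // /andP[ij /eqP ->]; rewrite inE => /eqP ->.
exact: (cong_step [::] r (braid_near ij)).
Qed.

Lemma braid_rel_sym u v : braid_rel u v -> braid_rel v u.
Proof.
by case=> i j ij; [apply: braid_far|apply: braid_near]; rewrite orbC.
Qed.

Definition rw_closed (l : seq (seq gen)) :=
  all (fun w => all (mem l) (rewrites w)) l.

Lemma rw_closed_cong l u v : rw_closed l -> cong braid_rel u v ->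
  (u \in l) = (v \in l).
Proof.
move=> cl; elim=> {u v} [//|u v _ ->//|u v w _ -> _ ->//|p q u v uv].
apply/idP/idP => h.
  exact: (allP (allP cl _ h) _ (rewrites_complete p q uv)).
exact: (allP (allP cl _ h) _ (rewrites_complete p q (braid_rel_sym uv))).
Qed.

(* 16 rounds are enough for the words used below; whether they are is checked
   by [rw_closed]. *)
Definition word_class (w : seq gen) : seq (seq gen) :=
  iter 16 (fun l => undup (l ++ flatten (map rewrites l))) [:: w].

Arguments word_class : simpl never.

Lemma word_class_sound w v : v \in word_class w -> cong braid_rel w v.
Proof.
rewrite /word_class; elim: 16%N v => [|n IH] v /=.
  by rewrite inE => /eqP ->; exact: cong_refl.
rewrite mem_undup mem_cat.
case/orP=> [/IH//|/flatten_mapP[u /IH wu /rewrites_sound]].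
exact: cong_trans.
Qed.

Lemma mem_word_class w v : rw_closed (word_class w) ->
  v \in word_class w <-> posbraid_of w = posbraid_of v.
Proof.
move=> cl; split=> [/word_class_sound /class_ofP //|/class_ofP wv].
rewrite -(rw_closed_cong cl wv) /word_class.
elim: 16%N => [|n IH]; first by rewrite inE.
by rewrite iterS mem_undup mem_cat IH.
Qed.

Definition suffixes (l : seq (seq gen)) : seq (seq gen) :=
  [seq drop k w | w <- l, k <- iota 0 (size w).+1].

Definition prefixes (l : seq (seq gen)) : seq (seq gen) :=
  [seq take k w | w <- l, k <- iota 0 (size w).+1].

Lemma mem_suffixes l u : u \in suffixes l <-> exists p, p ++ u \in l.
Proof.
split=> [/allpairsPdep[w [k [wl _ ->]]]|[p pu]].
  by exists (take k w); rewrite cat_take_drop.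
apply/allpairsPdep; exists (p ++ u), (size p); split=> //.
  by rewrite mem_iota add0n ltnS size_cat /= leq_addr.
by rewrite drop_size_cat.
Qed.

Lemma mem_prefixes l u : u \in prefixes l <-> exists p, u ++ p \in l.
Proof.
split=> [/allpairsPdep[w [k [wl _ ->]]]|[p pu]].
  by exists (drop k w); rewrite cat_take_drop.
apply/allpairsPdep; exists (u ++ p), (size u); split=> //.
  by rewrite mem_iota add0n ltnS size_cat /= leq_addr.
by rewrite take_size_cat.
Qed.

(* The words (sigma_1)(sigma_2 sigma_1)...(sigma_n-1 ... sigma_1), each factor
   being truncated on the right. *)
Fixpoint simple_words (n : nat) : seq (seq gen) :=
  if n is m.+1 then
    [seq a ++ rev (iota (m - k) k) | a <- simple_words m, k <- iota 0 m.+1]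
  else [:: [::]].

Definition left_descent (s : seq gen) (i : gen) : bool :=
  has (fun u => ohead u == Some i) (word_class s).

Definition right_descent (s : seq gen) (i : gen) : bool :=
  has (fun u => ohead (rev u) == Some i) (word_class s).

Arguments left_descent : simpl never.
Arguments right_descent : simpl never.

Lemma left_descentP s i : rw_closed (word_class s) ->
  left_descent s i <-> posbraid_dvd (gn i) (posbraid_of s).
Proof.
rewrite /left_descent; move: (mem_word_class (w := s)).
move: (word_class s) => l clE cl.
split=> [/hasP[[|j u] //= /(clE _ cl) -> /eqP[->]]|].
  by exists (posbraid_of u); rewrite -posbraid_ofM.
case=> x; elim/posbraid_ind: x => u; rewrite -posbraid_ofM => /(clE _ cl) h.
by apply/hasP; exists (i :: u); rewrite //= eqxx.
Qed.

Lemma right_descentP s i : rw_closed (word_class s) ->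
  right_descent s i <-> rdvd (gn i) (posbraid_of s).
Proof.
rewrite /right_descent; move: (mem_word_class (w := s)).
move: (word_class s) => l clE cl; split=> [/hasP[u]|].
  case/lastP: u => [//|u j /(clE _ cl) ->]; rewrite rev_rcons => /eqP[->].
  by exists (posbraid_of u); rewrite posbraid_rcons.
case=> x; elim/posbraid_ind: x => u; rewrite -posbraid_rcons => /(clE _ cl) h.
by apply/hasP; exists (rcons u i); rewrite // rev_rcons /= eqxx.
Qed.

(** Once [cl] is known to be a whole class, [sf] contains every word of every simple braid, so
    squares need only be sought in the first two letters. The [foldr] replaces a big operator, which
    is locked and does not compute. The last clause finds $u$ and $j$ with $\Delta=\sigma_i
    u=u\sigma_j$, whence $\sigma_i\Delta=\sigma_i u\sigma_j=\Delta\sigma_j$. *)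
Definition garside_check (N : nat) (w : seq gen) (S : seq (seq gen)) : bool :=
  let cl := word_class w in let sf := suffixes cl in let pf := prefixes cl in
  let I := iota 0 N in
  [&& rw_closed cl, all (fun s => rw_closed (word_class s)) S,
      uniq S, [::] \in S & [&&
      foldr maxn 0%N (map gen_index w) == N,
      all (mem sf) S,
      all (fun u => has (fun s => u \in word_class s) S) sf,
      all (fun s => all (fun t => (t \in word_class s) ==> (s == t)) S) S
    & [&& all (fun u => if u is i :: j :: _ then i != j else true) sf,
      all (fun s => all (fun i => left_descent s i || (i :: s \in sf)) I) S,
      all (mem sf) pf, all (mem pf) sf
    & [&& all (fun i => [:: i] \in sf) I
    & all (fun i => has (fun u => has (fun j =>
        (ohead u == Some i) && (rcons (behead u) j \in cl)) I) cl) I]]]].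

Lemma garside_checkP N w S : garside_check N w S ->
  garside_data N (posbraid_of w) S left_descent right_descent.
Proof.
rewrite /garside_check; cbv zeta.
set cl := word_class w; move: (mem_word_class (w := w)); rewrite -/cl.
move: cl => cl clE.
case/and5P=> ccl cS uS nS /and5P[/eqP mainN Ssf sfS injS].
case/and5P=> sqf ext pfsf sfpf /andP[gnsf cen].
have simpleE u : simple (posbraid_of w) (posbraid_of u) <-> u \in suffixes cl.
  split=> [[x]|/mem_suffixes[p /(clE _ ccl) ->]]; last first.
    by exists (posbraid_of p); rewrite posbraid_ofM.
  elim/posbraid_ind: x => p; rewrite -posbraid_ofM => /(clE _ ccl).
  by move=> h; apply/mem_suffixes; exists p.
have dvdE u :
    posbraid_dvd (posbraid_of u) (posbraid_of w) <-> u \in prefixes cl.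
  split=> [[x]|/mem_prefixes[p /(clE _ ccl) ->]]; last first.
    by exists (posbraid_of p); rewrite posbraid_ofM.
  elim/posbraid_ind: x => p; rewrite -posbraid_ofM => /(clE _ ccl).
  by move=> h; apply/mem_prefixes; exists p.
have clS s : s \in S -> rw_closed (word_class s) by move/(allP cS).
have in_I i : (i < N)%N -> i \in iota 0 N by rewrite mem_iota add0n.
have simpleP x :
    simple (posbraid_of w) x <-> exists2 s, s \in S & x = posbraid_of s.
  split=> [|[s sS ->]]; last by apply/simpleE; exact: (allP Ssf).
  elim/posbraid_ind: x => u /simpleE /(allP sfS) /hasP[s sS us].
  by exists s => //; apply/esym/mem_word_class => //; exact: clS.
split.
- rewrite posbraid_mainE -mainN /pos_main_index.
  by elim: (w) => [|k v IH]; rewrite ?big_nil // big_cons IH.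
- exact: simpleP.
- move=> s t sS tS /(mem_word_class _ (clS _ sS)) st.
  by have := allP (allP injS s sS) t tS; rewrite st => /eqP.
- exact: uS.
- exact: nS.
- by move=> s i sS iN; apply/left_descentP/clS.
- by move=> s i sS iN; apply/right_descentP/clS.
- move=> i t; elim/posbraid_ind: t => u.
  rewrite -(posbraid_ofM [:: i] u) -(posbraid_ofM [:: i]).
  move=> /simpleE /(allP sqf).
  by rewrite /= ?eqxx.
- move=> i s iN /simpleP[t tS ->] ndt.
  have := allP (allP ext t tS) i (in_I i iN); case/orP.
    by move/(left_descentP _ (clS _ tS)).
  by move/simpleE; rewrite -(posbraid_ofM [:: i] t).
- move=> x; elim/posbraid_ind: x => u.
  split=> [/simpleE /(allP sfpf) h|/dvdE /(allP pfsf) h]; first exact/dvdE.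
  exact/simpleE.
- by move=> i iN; apply/simpleE; exact: (allP gnsf _ (in_I i iN)).
move=> i iN.
have /hasP[u ucl /hasP[j _ /andP[ui uj]]] := allP cen i (in_I i iN).
case: u ui ucl uj => [/eqP //|k u /eqP[->] ucl uj]; exists j.
have e1 : posbraid_of w = gn i * posbraid_of u.
  by rewrite -(posbraid_ofM [:: i] u); exact/clE.
have e2 : posbraid_of w = posbraid_of u * gn j.
  by rewrite -posbraid_rcons; exact/clE.
by rewrite {1}e2 e1 mulgA.
Qed.

Lemma garside_data3 :
  garside_data 2 (Delta 3) (simple_words 3) left_descent right_descent.
Proof. by rewrite Delta3E; apply: garside_checkP; vm_compute. Qed.

Lemma Delta4E : Delta 4 = posbraid_of [:: 0; 1; 2; 0; 1; 0]%N.
Proof.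
rewrite /Delta unlock /= !mulg1.
rewrite -[[:: _, _ & _]]/([:: 0] ++ [:: 1] ++ [:: 2] ++ [:: 0] ++ [:: 1] ++
  [:: 0])%N.
by rewrite !posbraid_ofM !mulgA.
Qed.

Lemma garside_data4 :
  garside_data 3 (Delta 4) (simple_words 4) left_descent right_descent.
Proof. by rewrite Delta4E; apply: garside_checkP; vm_compute. Qed.

Local Close Scope group_scope.

(** * The transfer matrix on descent sets *)

Definition descents (N : nat) (s : seq gen) : bitseq :=
  [seq right_descent s i | i <- iota 0 N].

(* The descent sets of the factors which can follow in a normal form a factor
   with descent set b. *)
Definition next_descents (N : nat) (b : bitseq) : seq bitseq :=
  [seq descents N t | t <- simple_words N.+1
     & all (fun i => nth false b i ==> left_descent t i) (iota 0 N)].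

Definition head_bits (r : nat) (b : bitseq) : nat := all negb (take r b).

(** The iterates of [transfer], which depend on a word only through its right descents; this leaves
    $2^N$ states. *)
Definition nf_count_def (N r d : nat) : bitseq -> nat :=
  iter d (fun G b => sumn [seq G c | c <- next_descents N b]) (head_bits r).

(* Locked, since unification would otherwise evaluate [next_descents]. *)
Definition nf_count := locked nf_count_def.

Lemma nf_countS N r d b : nf_count N r d.+1 b =
  sumn [seq nf_count N r d c | c <- next_descents N b].
Proof. by rewrite /nf_count -lock. Qed.

Lemma nf_count0 N r b : nf_count N r 0 b = head_bits r b.
Proof. by rewrite /nf_count -lock. Qed.

Lemma nth_descents N s i : (i < N)%N ->
  nth false (descents N s) i = right_descent s i.
Proof. by move=> iN; rewrite (nth_map 0%N) ?size_iota // nth_iota. Qed.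

Lemma nf_countE N r d s : (r <= N)%N ->
  iter d (transfer N (simple_words N.+1) left_descent right_descent)
    (head_word right_descent r) s = nf_count N r d (descents N s).
Proof.
move=> rN; elim: d s => [|d IH] s.
  rewrite nf_count0 [iter 0 _ _]/= /head_word /head_bits /descents.
  by rewrite -map_take take_iota (minn_idPl rN) all_map.
rewrite iterS nf_countS /transfer /next_descents -map_comp sumnE big_map.
rewrite big_filter (eq_bigl (compat N left_descent right_descent s)) //.
  by apply: eq_bigr => t _; rewrite IH.
rewrite /compat => t; apply: eq_in_all => i.
rewrite mem_iota add0n => /andP[_ iN].
by rewrite nth_descents.
Qed.

Section Heights.

Variable N : nat.
Hypothesis GD : garside_data N (Delta N.+1) (simple_words N.+1)
  left_descent right_descent.

Lemma main_Delta_exp d : (0 < d)%N -> posbraid_main (Delta N.+1 ^+ d)%g = N.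
Proof.
case: d => // d _; apply/eqP; rewrite eqn_leq (main_exp GD) expgS.
by rewrite posbraid_main_mul leq_max (gd_main GD) leqnn.
Qed.

Lemma height_count r d : (r <= N)%N -> (0 < d)%N ->
  height r.+1 (Delta N.+1 ^+ d)%g = nf_count N r d (nseq N false).
Proof.
move=> rN d0.
have DL := mem_nf_seq GD d; have uL := nf_seq_uniq GD d.
rewrite (height_heads uL DL); last by rewrite main_Delta_exp.
rewrite (size_heads GD) // nf_countE //; congr nf_count.
apply: (@eq_from_nth _ false).
  by rewrite /descents size_map size_iota size_nseq.
rewrite /descents size_map size_iota -/(descents N _).
move=> i iN; rewrite nth_descents // nth_nseq iN.
by apply/negbTE/negP => /(gd_dr GD (gd_nil GD) iN); exact: rdvd_1.
Qed.

Lemma height_complexity m d : N = m.+1 -> (0 < d)%N ->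
  height N (Delta N.+1 ^+ d)%g = (complexity (Delta N.+1 ^+ d)%g + 1)%N.
Proof.
move=> Nm d0; have DL := mem_nf_seq GD d; have uL := nf_seq_uniq GD d.
have zm : posbraid_main (Delta N.+1 ^+ d)%g = m.+1 by rewrite main_Delta_exp.
rewrite [in LHS]Nm -Nm.
rewrite -(complexity_heads uL DL zm).
  by rewrite Nm.
set L := map fst _ in DL *.
(* The main letter is the second head, besides 1, that [complexity_heads] asks for. *)
have mh : gn m \in heads L m.
  apply/(mem_heads DL); split.
    have mN : (m < N)%N by rewrite Nm.
    have /(gd_ldvd GD) := gd_gn GD mN; case: (d) d0 => // d' _ h.
    by apply: dvd_trans h _; rewrite expgS; exists (Delta N.+1 ^+ d')%g.
  move=> i im [x e]; have := congr1 posbraid_main e.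
  have /pbsize_eq0 -> : pbsize x = 0%N.
    by have := congr1 pbsize e; rewrite pbsizeM !pbsize_gn; lia.
  by rewrite mul1g !gn_main => -[mi]; rewrite mi ltnn in im.
have h1 : 1%g \in heads L m.
  apply/(mem_heads DL); split; last exact: is_head1.
  by exists (Delta N.+1 ^+ d)%g; rewrite mul1g.
apply: (@uniq_leq_size _ [:: 1%g; gn m]); last first.
  by move=> x; rewrite !inE => /orP[] /eqP ->.
rewrite /= inE andbT; apply/eqP => e; have := congr1 pbsize e.
by rewrite pbsize1 pbsize_gn.
Qed.

End Heights.

(** * Closed forms of the counts, for all descent sets at once *)

Section Numerics.

Variable R : realType.

Lemma natr_nf_countS N r d b : (nf_count N r d.+1 b)%:R =
  foldr (fun c x => (nf_count N r d c)%:R + x) 0 (next_descents N b) :> R.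
Proof.
by rewrite nf_countS; elim: (next_descents N b) => //= c s <-; rewrite natrD.
Qed.

Ltac next_descents_step := match goal with |- context [next_descents ?N ?b] =>
  let l := eval vm_compute in (next_descents N b) in
  rewrite (_ : next_descents N b = l); [|by vm_compute]
end.

Ltac nf_step :=
  rewrite natr_nf_countS; next_descents_step; rewrite [foldr _ _ _]/=.

Local Notation o := false.
Local Notation l := true.

Local Notation s6 := (Num.sqrt 6 : R).

(* pa and pb are eigencomponents of the transfer matrix written without square
   roots: they satisfy a linear recurrence with integer coefficients. *)
Let pa d : R := (3 + s6) ^+ d + (3 - s6) ^+ d.
Let pb d : R := s6 * ((3 + s6) ^+ d - (3 - s6) ^+ d).

Lemma sqr_s6 : s6 * s6 = 6.
Proof. by rewrite -expr2 sqr_sqrtr. Qed.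

Let pa0 : pa 0 = 2. Proof. by rewrite /pa !expr0; lra. Qed.
Let pb0 : pb 0 = 0. Proof. by rewrite /pb !expr0 subrr mulr0. Qed.

Let paS d : pa d.+1 = 3 * pa d + pb d.
Proof. by rewrite /pa /pb !exprS; ring. Qed.

Let pbS d : pb d.+1 = 6 * pa d + 3 * pb d.
Proof. by rewrite -sqr_s6 /pa /pb !exprS; ring. Qed.

Let pa1 : pa 1 = 6. Proof. by rewrite paS pa0 pb0; lra. Qed.
Let pb1 : pb 1 = 12. Proof. by rewrite pbS pa0 pb0; lra. Qed.

(** Only the empty word has no descent and only $\Delta$ has all of them, so the empty and the full
    state each return to themselves once. The eigenvalue 1 is thus double, and its Jordan block
    gives the term linear in [d]. *)
Lemma nf_count3_0 d :
  [/\ (nf_count 2 0 d [:: o; o])%:R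
        = 8 * 2 ^+ d - 3 * d%:R - 7 :> R,
      (nf_count 2 0 d [:: l; o])%:R
        = 2 * 2 ^+ d - 1 :> R,
      (nf_count 2 0 d [:: l; l])%:R
        = 1 :> R
    & (nf_count 2 0 d [:: o; l])%:R
        = 2 * 2 ^+ d - 1 :> R].
Proof.
elim: d => [|d [H1 H2 H3 H4]].
  by split; rewrite ?nf_count0 /head_bits /= ?pa0 ?pb0 ?expr0; lra.
by split; nf_step; rewrite ?H1 ?H2 ?H3 ?H4;
  clear H1 H2 H3 H4; rewrite ?(paS, pbS) ?exprS -?(natr1 _ d); lra.
Qed.

(** The closed forms start with one factor: for [d = 0] the states [[:: l; o]] and [[:: o; l]] count
    0 and 1, while their rows in the transfer matrix agree. This difference lies in the kernel. *)
Lemma nf_count3_1 d :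
  [/\ (nf_count 2 1 d.+1 [:: o; o])%:R
        = 2 * 2 ^+ d.+1 - 1 :> R,
      (nf_count 2 1 d.+1 [:: l; o])%:R
        = 1 / 2 * 2 ^+ d.+1 :> R,
      (nf_count 2 1 d.+1 [:: l; l])%:R
        = 0 :> R
    & (nf_count 2 1 d.+1 [:: o; l])%:R
        = 1 / 2 * 2 ^+ d.+1 :> R].
Proof.
elim: d => [|d [H1 H2 H3 H4]].
  by split; nf_step; rewrite ?nf_count0 /head_bits /= ?pa1 ?pb1 ?expr1; lra.
by split; nf_step; rewrite ?H1 ?H2 ?H3 ?H4;
  clear H1 H2 H3 H4; rewrite ?(paS, pbS) ?exprS -?(natr1 _ d); lra.
Qed.

Lemma nf_count4_0 d :
  [/\ (nf_count 3 0 d [:: o; o; o])%:R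
        = 24 / 5 * pa d + 39 / 20 * pb d - 128 / 5 * 2 ^+ d + 6 * d%:R + 17
        :> R,
      (nf_count 3 0 d [:: l; o; o])%:R
        = 8 / 5 * pa d + 13 / 20 * pb d - 16 / 5 * 2 ^+ d + 1 :> R,
      (nf_count 3 0 d [:: l; l; o])%:R
        = 1 / 5 * pa d + 1 / 20 * pb d + 8 / 5 * 2 ^+ d - 1 :> R
    & (nf_count 3 0 d [:: l; l; l])%:R
        = 1 :> R]
  /\ [/\ (nf_count 3 0 d [:: l; o; l])%:R
        = 1 / 2 * pa d + 1 / 4 * pb d :> R,
      (nf_count 3 0 d [:: o; l; o])%:R
        = 8 / 5 * pa d + 13 / 20 * pb d - 16 / 5 * 2 ^+ d + 1 :> R,
      (nf_count 3 0 d [:: o; l; l])%:R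
        = 1 / 5 * pa d + 1 / 20 * pb d + 8 / 5 * 2 ^+ d - 1 :> R
    & (nf_count 3 0 d [:: o; o; l])%:R
        = 8 / 5 * pa d + 13 / 20 * pb d - 16 / 5 * 2 ^+ d + 1 :> R].
Proof.
elim: d => [|d [[H1 H2 H3 H4] [H5 H6 H7 H8]]].
  by split; split; rewrite ?nf_count0 /head_bits /= ?pa0 ?pb0 ?expr0; lra.
by split; split; nf_step; rewrite ?H1 ?H2 ?H3 ?H4 ?H5 ?H6 ?H7 ?H8;
  clear H1 H2 H3 H4 H5 H6 H7 H8; rewrite ?(paS, pbS) ?exprS -?(natr1 _ d); lra.
Qed.

Lemma nf_count4_1 d :
  [/\ (nf_count 3 1 d.+1 [:: o; o; o])%:R
        = 8 / 5 * pa d.+1 + 13 / 20 * pb d.+1 - 16 / 5 * 2 ^+ d.+1 + 1 :> R,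
      (nf_count 3 1 d.+1 [:: l; o; o])%:R
        = 8 / 15 * pa d.+1 + 13 / 60 * pb d.+1 - 2 / 5 * 2 ^+ d.+1 :> R,
      (nf_count 3 1 d.+1 [:: l; l; o])%:R
        = 1 / 15 * pa d.+1 + 1 / 60 * pb d.+1 + 1 / 5 * 2 ^+ d.+1 :> R
    & (nf_count 3 1 d.+1 [:: l; l; l])%:R
        = 0 :> R]
  /\ [/\ (nf_count 3 1 d.+1 [:: l; o; l])%:R
        = 1 / 6 * pa d.+1 + 1 / 12 * pb d.+1 :> R,
      (nf_count 3 1 d.+1 [:: o; l; o])%:R
        = 8 / 15 * pa d.+1 + 13 / 60 * pb d.+1 - 2 / 5 * 2 ^+ d.+1 :> R,
      (nf_count 3 1 d.+1 [:: o; l; l])%:R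
        = 1 / 15 * pa d.+1 + 1 / 60 * pb d.+1 + 1 / 5 * 2 ^+ d.+1 :> R
    & (nf_count 3 1 d.+1 [:: o; o; l])%:R
        = 8 / 15 * pa d.+1 + 13 / 60 * pb d.+1 - 2 / 5 * 2 ^+ d.+1 :> R].
Proof.
elim: d => [|d [[H1 H2 H3 H4] [H5 H6 H7 H8]]].
  by split; split; nf_step;
    rewrite ?nf_count0 /head_bits /= ?pa1 ?pb1 ?expr1; lra.
by split; split; nf_step; rewrite ?H1 ?H2 ?H3 ?H4 ?H5 ?H6 ?H7 ?H8;
  clear H1 H2 H3 H4 H5 H6 H7 H8; rewrite ?(paS, pbS) ?exprS -?(natr1 _ d); lra.
Qed.

Lemma nf_count4_2 d :
  [/\ (nf_count 3 2 d.+1 [:: o; o; o])%:R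
        = 1 / 5 * pa d.+1 + 1 / 20 * pb d.+1 + 8 / 5 * 2 ^+ d.+1 - 1 :> R,
      (nf_count 3 2 d.+1 [:: l; o; o])%:R
        = 1 / 15 * pa d.+1 + 1 / 60 * pb d.+1 + 1 / 5 * 2 ^+ d.+1 :> R,
      (nf_count 3 2 d.+1 [:: l; l; o])%:R
        = 2 / 15 * pa d.+1 - 1 / 20 * pb d.+1 - 1 / 10 * 2 ^+ d.+1 :> R
    & (nf_count 3 2 d.+1 [:: l; l; l])%:R
        = 0 :> R]
  /\ [/\ (nf_count 3 2 d.+1 [:: l; o; l])%:R
        = - 1 / 6 * pa d.+1 + 1 / 12 * pb d.+1 :> R,
      (nf_count 3 2 d.+1 [:: o; l; o])%:R
        = 1 / 15 * pa d.+1 + 1 / 60 * pb d.+1 + 1 / 5 * 2 ^+ d.+1 :> R,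
      (nf_count 3 2 d.+1 [:: o; l; l])%:R
        = 2 / 15 * pa d.+1 - 1 / 20 * pb d.+1 - 1 / 10 * 2 ^+ d.+1 :> R
    & (nf_count 3 2 d.+1 [:: o; o; l])%:R
        = 1 / 15 * pa d.+1 + 1 / 60 * pb d.+1 + 1 / 5 * 2 ^+ d.+1 :> R].
Proof.
elim: d => [|d [[H1 H2 H3 H4] [H5 H6 H7 H8]]].
  by split; split; nf_step;
    rewrite ?nf_count0 /head_bits /= ?pa1 ?pb1 ?expr1; lra.
by split; split; nf_step; rewrite ?H1 ?H2 ?H3 ?H4 ?H5 ?H6 ?H7 ?H8;
  clear H1 H2 H3 H4 H5 H6 H7 H8; rewrite ?(paS, pbS) ?exprS -?(natr1 _ d); lra.
Qed.

End Numerics.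

Theorem proposition3p17 (R : realType) (d : nat) (hd : (1 <= d)%N) :
  let s6 : R := Num.sqrt 6 in
  let rho1 : R := 3 + s6 in
  let rho2 : R := 3 - s6 in
  let D3 : posbraid := (Delta 3 ^+ d)%g in
  let D4 : posbraid := (Delta 4 ^+ d)%g in
  [/\ (height 1 D3)%:R = 8 * 2 ^+ d - 3 * d%:R - 7 :> R,
      height 2 D3 = (complexity D3 + 1)%N
        /\ (height 2 D3)%:R = 2 * 2 ^+ d - 1 :> R,
      (height 1 D4)%:R
        = 3 / 20 * (32 + 13 * s6) * rho1 ^+ d
          + 3 / 20 * (32 - 13 * s6) * rho2 ^+ d
          - 128 / 5 * 2 ^+ d + 6 * d%:R + 17 :> R,
      (height 2 D4)%:R
        = 1 / 20 * (32 + 13 * s6) * rho1 ^+ d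
          + 1 / 20 * (32 - 13 * s6) * rho2 ^+ d
          - 16 / 5 * 2 ^+ d + 1 :> R
    & height 3 D4 = (complexity D4 + 1)%N
        /\ (height 3 D4)%:R
           = 1 / 20 * (4 + s6) * rho1 ^+ d
             + 1 / 20 * (4 - s6) * rho2 ^+ d
             + 8 / 5 * 2 ^+ d - 1 :> R].
Proof.
have d1 : d = d.-1.+1 by rewrite prednK.
have lt3 r : (r <= 2)%N -> _ := fun h => height_count garside_data3 h hd.
have lt4 r : (r <= 3)%N -> _ := fun h => height_count garside_data4 h hd.
have [A0 _ _ _] := nf_count3_0 R d; have [A1 _ _ _] := nf_count3_1 R d.-1.
have [[B0 _ _ _] _] := nf_count4_0 R d.
have [[B1 _ _ _] _] := nf_count4_1 R d.-1.
have [[B2 _ _ _] _] := nf_count4_2 R d.-1.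
rewrite -d1 in A1 B1 B2.
split.
- by rewrite lt3 // A0.
- by split; [exact: (height_complexity garside_data3)|rewrite lt3 // A1].
(* Conjugate terms regroup into [pa] and [pb], with coefficients $\frac{3}{20}\cdot32=\frac{24}{5}$
   and $\frac{3}{20}\cdot13=\frac{39}{20}$. *)
- by rewrite lt4 // B0; lra.
- by rewrite lt4 // B1; lra.
- by split; [exact: (height_complexity garside_data4)|rewrite lt4 // B2; lra].
Qed.
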